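(* Let $\epsilon\in\{-1,+1\}$ and let $(M,g,J)$ be a connected $\epsilon$-Kähler manifold with $\dim M=2n\geqslant 4$. Suppose $(M,g,J)$ admits a non-degenerate homogeneous $\epsilon$-Kähler structure $S$ of linear type, given by vector fields $\xi$ and $\zeta$. Then $(M,g,J)$ has constant $\epsilon$-holomorphic sectional curvature $c=-4g(\xi,\xi)$, and $\zeta=0$.
   Context: Let $\epsilon=\pm1$. An almost $\epsilon$-Hermitian structure on a pseudo-Riemannian manifold $(M,g)$ is a smooth section $J$ of $\mathfrak{so}(TM)$ (endomorphisms skew-symmetric with respect to $g$) such that $J^2=\epsilon\,\mathrm{Id}$. The triple $(M,g,J)$ is $\epsilon$-Kähler if moreover $\nabla J=0$, where $\nabla$ is the Levi-Civita connection of $g$ (so $\epsilon=-1$ is the pseudo-Kähler case and $\epsilon=1$ the para-Kähler case). A homogeneous $\epsilon$-Kähler structure on $(M,g,J)$ is a tensor field $S$ of type $(1,2)$, written $(X,Y)\mapsto S_XY$, such that the connection $\widetilde\nabla=\nabla-S$ satisfies $\widetilde\nabla g=0$, $\widetilde\nabla R=0$, $\widetilde\nabla S=0$, $\widetilde\nabla J=0$, where $R$ is the curvature tensor of $g$. Such an $S$ is of linear type if there are vector fields $\xi,\zeta$ on $M$ with $$S_XY=g(X,Y)\xi-g(\xi,Y)X+\epsilon g(X,JY)J\xi-\epsilon g(\xi,JY)JX-2g(\zeta,JX)JY$$ for all $X,Y$; $S$ is then said to be given by $\xi$ and $\zeta$. It is non-degenerate if in addition $g(\xi,\xi)\neq0$.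 $(M,g,J)$ has constant $\epsilon$-holomorphic sectional curvature $c$ ($c$ a real constant) if $$R_{XYZW}=\tfrac{c}{4}\bigl\{g(Y,Z)g(X,W)-g(X,Z)g(Y,W)+\epsilon g(X,JZ)g(Y,JW)-\epsilon g(X,JW)g(Y,JZ)+2\epsilon g(X,JY)g(Z,JW)\bigr\},$$ where $R_{XYZW}=g(\nabla_X\nabla_YZ-\nabla_Y\nabla_XZ-\nabla_{[X,Y]}Z,\,W)$. *)

(* Defs.v *)
From HB Require Import structures.
From mathcomp Require Import all_boot all_order all_algebra.
From mathcomp Require Import ring lra.
From mathcomp Require Import all_classical all_reals all_analysis.
Import Order.TTheory GRing.Theory Num.Theory.
Import numFieldNormedType.Exports.

Set Implicit Arguments.
Unset Strict Implicit.
Unset Printing Implicit Defensive.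

Local Open Scope classical_set_scope.
Local Open Scope ring_scope.

(* Smooth maps on an open subset U of R^m.  Values of f outside U are junk,  *)
(* and 'D_v f x at a point x of the open set U only depends on f near x.     *)

Fixpoint Ck_on (R : realType) (m : nat) (V : normedModType R) (k : nat)
    (U : set 'rV[R]_m) (f : 'rV[R]_m -> V) : Prop :=
  (forall x, U x -> {for x, continuous f}) /\
  if k is k'.+1 then
    forall i : 'I_m, (forall x, U x -> derivable f x 'e_i) /\
                     Ck_on k' U (fun x => 'D_('e_i) f x)
  else True.

Definition smooth_on (R : realType) (m : nat) (V : normedModType R)
    (U : set 'rV[R]_m) (f : 'rV[R]_m -> V) : Prop :=
  forall k, Ck_on k U f.

(* The smooth structure is given by an atlas that need not be maximal.       *)

Record chart (R : realType) (m : nat) (T : topologicalType) := Chart {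
  dom : set T;
  cod : set 'rV[R]_m;
  coord : T -> 'rV[R]_m;
  param : 'rV[R]_m -> T;
  dom_open : open dom;
  cod_open : open cod;
  coord_cod : forall p, dom p -> cod (coord p);
  param_dom : forall x, cod x -> dom (param x);
  coordK : forall p, dom p -> param (coord p) = p;
  paramK : forall x, cod x -> coord (param x) = x;
  coord_continuous_on : forall p, dom p -> {for p, continuous coord};
  param_continuous_on : forall x, cod x -> {for x, continuous param} }.

Definition overlap (R : realType) (m : nat) (T : topologicalType)
    (a b : chart R m T) : set 'rV[R]_m :=
  [set x | cod a x /\ dom b (param a x)].

Definition transition (R : realType) (m : nat) (T : topologicalType)
    (a b : chart R m T) (x : 'rV[R]_m) : 'rV[R]_m :=
  coord b (param a x).

Record manifold (R : realType) (m : nat) := Manifold {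
  points :> topologicalType;
  atlas_index : Type;
  atlas : atlas_index -> chart R m points;
  manifold_hausdorff : hausdorff_space points;
  manifold_second_countable : @second_countable points;
  atlas_cover : forall p : points, exists a, dom (atlas a) p;
  atlas_smooth : forall a b,
    smooth_on (overlap (atlas a) (atlas b)) (transition (atlas a) (atlas b)) }.

(* A smooth tensor field is given by its components in the charts of the     *)
(* atlas, subject to the transformation law.  In the chart a, the tangent    *)
(* space at the point of coordinates x is 'rV_m; the change of charts from a *)
(* to b maps a tangent vector v at x to 'D_v (transition a b) x.  Components *)
(* are meaningful only on cod (atlas a).                                     *)

Definition push (R : realType) (m : nat) (M : manifold R m)
    (a b : atlas_index M) (x v : 'rV[R]_m) : 'rV[R]_m :=
  'D_v (transition (atlas a) (atlas b)) x.

Record vector_field (R : realType) (m : nat) (M : manifold R m) := VectorField {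
  vf :> atlas_index M -> 'rV[R]_m -> 'rV[R]_m;
  vf_smooth : forall a, smooth_on (cod (atlas a)) (vf a);
  vf_change : forall a b x, overlap (atlas a) (atlas b) x ->
    vf b (transition (atlas a) (atlas b) x) = push a b x (vf a x) }.

(* Fields of endomorphisms; vectors being rows, matrices act on the right.   *)
Definition app_mx (R : realType) (m : nat) (A : 'M[R]_m) (v : 'rV[R]_m) :
  'rV[R]_m := v *m A.

Record endo_field (R : realType) (m : nat) (M : manifold R m) := EndoField {
  endo_mx : atlas_index M -> 'rV[R]_m -> 'M[R]_m;
  endo_smooth : forall a, smooth_on (cod (atlas a)) (endo_mx a);
  endo_change : forall a b x v, overlap (atlas a) (atlas b) x ->
    app_mx (endo_mx b (transition (atlas a) (atlas b) x)) (push a b x v) =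
    push a b x (app_mx (endo_mx a x) v) }.

Definition endo (R : realType) (m : nat) (M : manifold R m) (J : endo_field M)
    (a : atlas_index M) (x v : 'rV[R]_m) : 'rV[R]_m :=
  app_mx (endo_mx J a x) v.

(* Tensor fields of type (1,2): the matrix S a i x represents S_(e_i).       *)
Definition app_mx2 (R : realType) (m : nat) (S : 'I_m -> 'M[R]_m)
    (u v : 'rV[R]_m) : 'rV[R]_m := \sum_i u 0 i *: app_mx (S i) v.

Record tensor12 (R : realType) (m : nat) (M : manifold R m) := Tensor12 {
  t12_mx : atlas_index M -> 'I_m -> 'rV[R]_m -> 'M[R]_m;
  t12_smooth : forall a i, smooth_on (cod (atlas a)) (t12_mx a i);
  t12_change : forall a b x u v, overlap (atlas a) (atlas b) x ->
    app_mx2 (fun i => t12_mx b i (transition (atlas a) (atlas b) x))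
      (push a b x u) (push a b x v) =
    push a b x (app_mx2 (fun i => t12_mx a i x) u v) }.

Definition t12 (R : realType) (m : nat) (M : manifold R m) (S : tensor12 M)
    (a : atlas_index M) (x u v : 'rV[R]_m) : 'rV[R]_m :=
  app_mx2 (fun i => t12_mx S a i x) u v.

Definition bilin (R : realType) (m : nat) (G : 'M[R]_m) (u v : 'rV[R]_m) : R :=
  (u *m G *m v^T) 0 0.

(* Pseudo-Riemannian metrics: the signature is not restricted.               *)
Record metric (R : realType) (m : nat) (M : manifold R m) := Metric {
  gram : atlas_index M -> 'rV[R]_m -> 'M[R]_m;
  gram_smooth : forall a, smooth_on (cod (atlas a)) (gram a);
  gram_sym : forall a x, cod (atlas a) x -> (gram a x)^T = gram a x;
  gram_unit : forall a x, cod (atlas a) x -> gram a x \in unitmx;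
  gram_change : forall a b x u v, overlap (atlas a) (atlas b) x ->
    bilin (gram b (transition (atlas a) (atlas b) x))
      (push a b x u) (push a b x v) =
    bilin (gram a x) u v }.

Definition inner (R : realType) (m : nat) (M : manifold R m) (g : metric M)
    (a : atlas_index M) (x u v : 'rV[R]_m) : R := bilin (gram g a x) u v.

(* Local calculus: X, Y, Z, W : 'rV_m -> 'rV_m are vector fields on the      *)
(* domain of the chart a, read in coordinates.                               *)

Definition local_field (R : realType) (m : nat) (M : manifold R m)
    (a : atlas_index M) (X : 'rV[R]_m -> 'rV[R]_m) : Prop :=
  smooth_on (cod (atlas a)) X.

Definition dirder (R : realType) (m : nat) (V : normedModType R)
    (X : 'rV[R]_m -> 'rV[R]_m) (f : 'rV[R]_m -> V) (x : 'rV[R]_m) : V :=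
  'D_(X x) f x.

Definition lie_bracket (R : realType) (m : nat) (X Y : 'rV[R]_m -> 'rV[R]_m)
    (x : 'rV[R]_m) : 'rV[R]_m :=
  dirder X Y x - dirder Y X x.

Section Connection.
Context (R : realType) (m : nat) (M : manifold R m) (g : metric M).
Implicit Types (a : atlas_index M) (X Y Z W : 'rV[R]_m -> 'rV[R]_m).

(* Christoffel symbols of the Levi-Civita connection:                        *)
(*   Gamma^k_ij = 1/2 \sum_l (d_i g_jl + d_j g_il - d_l g_ij) g^lk.          *)
(* levi_civita_torsion_free and christoffel_metric are its two defining      *)
(* properties, the second one on coordinate fields.                          *)
Definition dgram a (x : 'rV[R]_m) (l i j : 'I_m) : R :=
  'D_('e_l) (fun y => gram g a y i j) x.

Definition christoffel a (x : 'rV[R]_m) (i j k : 'I_m) : R :=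
  2^-1 * \sum_l (dgram a x i j l + dgram a x j i l - dgram a x l i j) *
                invmx (gram g a x) l k.

Definition levi_civita a X Y (x : 'rV[R]_m) : 'rV[R]_m :=
  dirder X Y x +
  \row_k \sum_i \sum_j X x 0 i * Y x 0 j * christoffel a x i j k.

Lemma dgram_sym a x l i j : cod (atlas a) x -> dgram a x l i j = dgram a x l j i.
Proof.
move=> xa; apply: near_eq_derive; near=> y.
have ya : cod (atlas a) y.
  by near: y; apply: open_nbhs_nbhs; split => //; exact: cod_open.
by rewrite -[in LHS](gram_sym g ya) mxE.
Unshelve. all: by end_near. Qed.

Lemma levi_civita_torsion_free a X Y x : cod (atlas a) x ->
  levi_civita a X Y x - levi_civita a Y X x = lie_bracket X Y x.
Proof.
move=> xa; rewrite /levi_civita /lie_bracket.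
set A := \row_k _; set B := \row_k _.
suff -> : A = B by rewrite opprD addrACA subrr addr0.
apply/rowP => k; rewrite !mxE exchange_big; apply: eq_bigr => i _.
apply: eq_bigr => j _; rewrite [X x 0 j * _]mulrC; congr (_ * (_ * _)).
apply: eq_bigr => l _; congr (_ * _).
by rewrite [dgram a x j i l + _]addrC (dgram_sym _ j i).
Qed.

Lemma christoffel_metric a x k i j : cod (atlas a) x ->
  dgram a x k i j =
  \sum_l christoffel a x k i l * gram g a x l j +
  \sum_l christoffel a x k j l * gram g a x i l.
Proof.
move=> xa.
have low p q r : \sum_l christoffel a x p q l * gram g a x l r =
    2^-1 * (dgram a x p q r + dgram a x q p r - dgram a x r p q).
  pose w := \row_s (dgram a x p q s + dgram a x q p s - dgram a x s p q).
  have := congr1 (fun v : 'rV_m => v 0 r)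
    (mulmxKV (gram_unit g xa) w).
  rewrite !mxE => <-; rewrite big_distrr; apply: eq_bigr => l _ /=.
  by rewrite !mxE mulrA; congr (_ * _ * _); apply: eq_bigr => s _; rewrite !mxE.
rewrite low (eq_bigr (fun l => christoffel a x k j l * gram g a x l i)); last first.
  by move=> l _; rewrite -[in LHS](gram_sym g xa) mxE.
rewrite low (dgram_sym k j i) // (dgram_sym j k i) // (dgram_sym i k j) //.
by rewrite (dgram_sym j i k) //; lra.
Qed.

Definition curvature a X Y Z (x : 'rV[R]_m) : 'rV[R]_m :=
  levi_civita a X (levi_civita a Y Z) x -
  levi_civita a Y (levi_civita a X Z) x -
  levi_civita a (lie_bracket X Y) Z x.

Definition riem a X Y Z W (x : 'rV[R]_m) : R :=
  inner g a x (curvature a X Y Z x) (W x).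

(* nablat stands for the connection nabla - S.                               *)
Definition nablat (S : tensor12 M) a X Y (x : 'rV[R]_m) : 'rV[R]_m :=
  levi_civita a X Y x - t12 S a x (X x) (Y x).

End Connection.

Section Kahler.
Context (R : realType) (m : nat) (M : manifold R m).
Implicit Types (g : metric M) (J : endo_field M) (S : tensor12 M).
Implicit Types (xi zeta : vector_field M) (eps c : R).

Definition almost_eps_hermitian eps g J : Prop :=
  forall a x, cod (atlas a) x ->
    (forall u v, inner g a x (endo J a x u) v = - inner g a x u (endo J a x v))
    /\ (forall u, endo J a x (endo J a x u) = eps *: u).

Definition eps_kahler eps g J : Prop :=
  almost_eps_hermitian eps g J /\
  forall a X Y, local_field a X -> local_field a Y ->
    forall x, cod (atlas a) x ->
      levi_civita g a X (fun y => endo J a y (Y y)) x =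
      endo J a x (levi_civita g a X Y x).

Definition nablat_g_zero g S : Prop :=
  forall a X Y Z, local_field a X -> local_field a Y -> local_field a Z ->
    forall x, cod (atlas a) x ->
      dirder X (fun y => inner g a y (Y y) (Z y)) x =
      inner g a x (nablat g S a X Y x) (Z x) +
      inner g a x (Y x) (nablat g S a X Z x).

Definition nablat_R_zero g S : Prop :=
  forall a X Y Z V W, local_field a X -> local_field a Y -> local_field a Z ->
    local_field a V -> local_field a W ->
    forall x, cod (atlas a) x ->
      dirder X (riem g a Y Z V W) x =
      riem g a (nablat g S a X Y) Z V W x +
      riem g a Y (nablat g S a X Z) V W x +
      riem g a Y Z (nablat g S a X V) W x +
      riem g a Y Z V (nablat g S a X W) x.

Definition nablat_S_zero g S : Prop :=
  forall a X Y Z, local_field a X -> local_field a Y -> local_field a Z ->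
    forall x, cod (atlas a) x ->
      nablat g S a X (fun y => t12 S a y (Y y) (Z y)) x =
      t12 S a x (nablat g S a X Y x) (Z x) +
      t12 S a x (Y x) (nablat g S a X Z x).

Definition nablat_J_zero g J S : Prop :=
  forall a X Y, local_field a X -> local_field a Y ->
    forall x, cod (atlas a) x ->
      nablat g S a X (fun y => endo J a y (Y y)) x =
      endo J a x (nablat g S a X Y x).

Definition homogeneous_eps_kahler g J S : Prop :=
  [/\ nablat_g_zero g S, nablat_R_zero g S, nablat_S_zero g S
    & nablat_J_zero g J S].

Definition linear_type eps g J S xi zeta : Prop :=
  forall a x, cod (atlas a) x -> forall u v,
    t12 S a x u v =
      inner g a x u v *: xi a x - inner g a x (xi a x) v *: u
      + (eps * inner g a x u (endo J a x v)) *: endo J a x (xi a x)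
      - (eps * inner g a x (xi a x) (endo J a x v)) *: endo J a x u
      - (2 * inner g a x (zeta a x) (endo J a x u)) *: endo J a x v.

Definition non_degenerate g xi : Prop :=
  forall a x, cod (atlas a) x -> inner g a x (xi a x) (xi a x) != 0.

Definition constant_hol_curvature eps g J c : Prop :=
  forall a X Y Z W, local_field a X -> local_field a Y -> local_field a Z ->
    local_field a W ->
    forall x, cod (atlas a) x ->
      let G u v := inner g a x u v in
      let Jx u := endo J a x u in
      riem g a X Y Z W x =
      c / 4 * (G (Y x) (Z x) * G (X x) (W x) - G (X x) (Z x) * G (Y x) (W x)
        + eps * G (X x) (Jx (Z x)) * G (Y x) (Jx (W x))
        - eps * G (X x) (Jx (W x)) * G (Y x) (Jx (Z x))
        + 2 * eps * G (X x) (Jx (Y x)) * G (Z x) (Jx (W x))).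

End Kahler.

(* Main.v *)
Require Import Defs.
From HB Require Import structures.
From mathcomp Require Import all_boot all_order all_algebra.
From mathcomp Require Import ring lra.
From mathcomp Require Import all_classical all_reals all_analysis.
Import Order.TTheory GRing.Theory Num.Theory.
Import numFieldNormedType.Exports.

(* Since [nabla - S] kills [g], [J] and [S], differentiating the linear form  *)
(* of [S] shows that it also kills [xi] and [zeta].  Hence [nabla xi = S xi], *)
(* which determines [R(X,Y)xi] algebraically:                                 *)
(*   R(X,Y)xi = [S_X, S_Y] xi - S_(S_X Y - S_Y X) xi,                         *)
(* and makes [g(xi,xi)] locally constant.  With [lam X = -2 g(zeta, J X)],    *)
(* the identity [R(JX,JY) = -eps R(X,Y)] on vectors orthogonal to [xi] and    *)
(* [J xi] forces [lam xi = lam (J xi) = 0], and the symmetry in [X, Y] of     *)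
(* [g(R(xi,X)xi, Y)] at [Y = J xi] then forces [lam = 0], i.e. [zeta = 0].    *)
(* Now [S_xi = 0] and [S_X xi = - g(xi,xi) X] modulo [xi], [J xi]; inserting  *)
(* [nabla R = S R] in the second Bianchi identity for [xi, X, Y] expresses    *)
(* [2 g(xi,xi) R(X,Y)] through terms [R(xi,.)] and [R(J xi,.)], which are     *)
(* known.                                                                     *)

Set Implicit Arguments.
Unset Strict Implicit.
Unset Printing Implicit Defensive.

Local Open Scope classical_set_scope.
Local Open Scope ring_scope.

(** * Directional derivatives *)

(** The argument separates into linear algebra at one point and calculus in one chart.

    At a point, [G], [J] and a tensor [T] with the symmetries of a Kähler curvature tensor are
    given, together with two identities: [Txi], which expresses [T u v xi] through [xi] and [zeta],
    and [Tcyc], the second Bianchi identity after [nabla R] has been replaced by the action of [S]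
    on [R]. The compatibility of [Txi] with the symmetries of [T] is so restrictive that it forces
    [zeta = 0] ([zeta_eq0]). Then [Tcyc] can be solved for [T x y z w], which occurs in it with the
    invertible factor [2 * G xi xi] ([T_hol_form]).

    In a chart, tangent vectors are extended to constant fields, which commute, so no Lie bracket
    appears. The linear form of [S] determines its two vectors ([Slin_inj]), hence [xi] and [zeta]
    are parallel for [nabla - S] ([nabt_xi_zeta]); this yields [Txi] ([curv_xi]) and, with
    [nablat_R_zero], [Tcyc] ([curv4_cyclic]). Smoothness is phrased with partial derivatives only,
    so linearity in the direction ([smooth_is_derive]) and symmetry of second derivatives
    ([smooth_derive_comm]) have to be proved; the symmetry is what makes the curvature tensorial and
    skew.

    Parallelism of [xi] also makes [g(xi,xi)] locally constant, and connectedness turns it into one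
    number ([chart_constant]). *)

Section Directional.
Context (R : realType) (V : normedModType R).
Implicit Types (f : V -> R) (x v w e : V).

Lemma is_derive_translate f x w v df :
  is_derive (x + w) v f df -> is_derive x v (fun y => f (y + w)) df.
Proof.
case=> fd fE; have E : (fun h => h^-1 *: (((fun y => f (y + w)) \o shift x) (h *: v)
    - f (x + w))) = (fun h => h^-1 *: ((f \o shift (x + w)) (h *: v) - f (x + w))).
  by apply/funext => h /=; rewrite addrA.
by split; [rewrite /derivable E|rewrite /derive E].
Qed.

Lemma is_derive_line f x e (t : R) :
  derivable f (x + t *: e) e ->
  is_derive t 1 (fun s : R => f (x + s *: e)) ('D_e f (x + t *: e)).
Proof.
move=> fd; have E : (fun h => h^-1 *: (((fun s : R => f (x + s *: e)) \o shift t)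
    (h *: 1) - f (x + t *: e))) =
    (fun h => h^-1 *: ((f \o shift (x + t *: e)) (h *: e) - f (x + t *: e))).
  by apply/funext => h /=; rewrite [h *: 1]mulr1 scalerDl addrCA.
by split; [rewrite /derivable E|rewrite /derive E].
Qed.

(** Mean value theorem on a line. Bounding [c] in absolute value treats both signs of [s] at once
    and suits arguments inside balls. *)
Lemma mean_value_line f x e (s : R) :
  (forall t, `|t| <= `|s| -> derivable f (x + t *: e) e) ->
  exists2 c, `|c| <= `|s| & f (x + s *: e) - f x = s * 'D_e f (x + c *: e).
Proof.
move=> fd; pose p (t : R) := f (x + t *: e).
have pd (t : R) : `|t| <= `|s| -> is_derive t 1 p ('D_e f (x + t *: e)).
  by move=> ts; apply: is_derive_line; exact: fd.
have p0 : p 0 = f x by rewrite /p scale0r addr0.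
rewrite -[f (x + s *: e)]/(p s) -p0.
have [s0|s0] := leP 0 s.
  have ins c : c \in `[0, s] -> `|c| <= `|s|.
    by rewrite in_itv /= => /andP[c0 cs]; rewrite !ger0_norm.
  have [||c cs E] := @MVT_segment R p (fun t => 'D_e f (x + t *: e)) 0 s s0.
  - by move=> t ts; apply/pd/ins; apply: subset_itv_oo_cc ts.
  - by apply: derivable_within_continuous => t /ins ts; have [] := pd t ts.
  - by exists c; [exact: ins|rewrite E subr0 mulrC].
have ins c : c \in `[s, 0] -> `|c| <= `|s|.
  by rewrite in_itv /= => /andP[c0 cs]; rewrite !ler0_norm ?lerN2 // ltW.
have [||c cs E] := @MVT_segment R p (fun t => 'D_e f (x + t *: e)) s 0 (ltW s0).
- by move=> t ts; apply/pd/ins; apply: subset_itv_oo_cc ts.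
- by apply: derivable_within_continuous => t /ins ts; have [] := pd t ts.
- by exists c; [exact: ins|rewrite -opprB E sub0r mulrN opprK mulrC].
Qed.

(** One step of the proof that continuous partial derivatives give all directional ones: the
    increment along [v + c *: e] is the increment along [v], plus a move along [e] to which the mean
    value theorem applies. *)
Lemma is_derive_add_dir f x v e (c L : R) : is_derive x v f L ->
  (\forall y \near x, derivable f y e) ->
  {for x, continuous ('D_e f)} ->
  is_derive x (v + c *: e) f (L + c * 'D_e f x).
Proof.
move=> [fd fE] /nbhs_ballP[d1 /= d10 fde] /cvgrPdist_le ce.
suff H : h^-1 *: ((f \o shift x) (h *: (v + c *: e)) - f x) @[h --> 0^'] -->
    L + c * 'D_e f x.
  by split; [apply/cvg_ex; exists (L + c * 'D_e f x)|apply/cvg_lim].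
have {}fd : h^-1 *: ((f \o shift x) (h *: v) - f x) @[h --> 0^'] --> L.
  by rewrite -fE; exact: fd.
apply/cvgrPdist_le => eps eps0.
(* The added 1 keeps the divisor positive when [c = 0]. *)
have k0 : 0 < `|c| + 1 by rewrite ltr_wpDl.
have e2 : 0 < eps / 2 / (`|c| + 1) by rewrite !divr_gt0.
have /nbhs_ballP[d2 /= d20 De] := ce _ e2.
pose d := Num.min d1 d2; have d0 : 0 < d by rewrite lt_min d10.
(* Every point met by the two moves lies within [|h| * K] of [x]. *)
pose K := `|v| + `|c| * `|e| + 1.
have K0 : 0 < K by rewrite ltr_wpDl // addr_ge0 // mulr_ge0.
have hd2 : 0 < eps / 2 by rewrite divr_gt0.
near=> h.
have h0 : h != 0 by near: h; exact: nbhs_dnbhs_neq.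
have hK : `|h| < d / K by near: h; apply: dnbhs0_lt; rewrite divr_gt0.
have inball t : `|t| <= `|h * c| -> ball x d ((h *: v + x) + t *: e).
  move=> tc; rewrite -ball_normE /= [h *: v + x]addrC -addrA opprD addNKr normrN.
  apply: le_lt_trans (ler_normD _ _) _; rewrite !normrZ.
  apply: (@le_lt_trans _ _ (`|h| * K)); last by rewrite -ltr_pdivlMr.
  rewrite /K !mulrDr mulr1 -addrA lerD //.
  apply: (@le_trans _ _ (`|h| * (`|c| * `|e|))); last by rewrite lerDl.
  by rewrite mulrA -normrM ler_wpM2r.
have [|t tc E] := @mean_value_line f (h *: v + x) e (h * c).
  move=> t /inball tb; apply: fde; apply: le_ball tb; rewrite /d.
  by rewrite ge_min lexx.
have -> : h^-1 *: ((f \o shift x) (h *: (v + c *: e)) - f x) =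
    h^-1 *: ((f \o shift x) (h *: v) - f x) + c * 'D_e f (h *: v + x + t *: e).
  rewrite /= [h *: (_ + _)]scalerDr [h *: (c *: e)]scalerA [h *: v + _ + x]addrAC.
  have -> : f (h *: v + x + (h * c) *: e) - f x = (f (h *: v + x) - f x) +
     (h * c) * 'D_e f (h *: v + x + t *: e) by rewrite -E [RHS]addrC addrA subrK.
  rewrite scalerDr; congr (_ + _).
  by rewrite [_ *: _]mulrA mulKf.
rewrite opprD addrACA -mulrBr.
apply: le_trans (ler_normD _ _) _; rewrite [eps]splitr lerD //.
  by near: h; move/cvgrPdist_le: fd => /(_ _ hd2).
have : `|'D_e f x - 'D_e f (h *: v + x + t *: e)| <= eps / 2 / (`|c| + 1).
  apply: De; apply: (@le_ball _ _ _ d); first by rewrite /d ge_min lexx orbT.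
  exact: inball.
move=> Dt; rewrite normrM; apply: (@le_trans _ _ (`|c| * (eps / 2 / (`|c| + 1)))).
  by rewrite ler_wpM2l.
rewrite mulrA ler_pdivrMr // mulrC ler_pM2l //.
by rewrite lerDl.
Unshelve. all: by end_near. Qed.

(** The second difference over a parallelogram: the mean value theorem along [e] for
    [f (y + s *: e') - f y], then along [e'] for ['D_e f]. *)
Lemma mean_value_square f x e e' (s : R) :
  (forall a b, `|a| <= `|s| -> `|b| <= `|s| ->
    derivable f (x + a *: e + b *: e') e /\
    derivable ('D_e f) (x + a *: e + b *: e') e') ->
  exists a b : R, [/\ `|a| <= `|s|, `|b| <= `|s| &
    f (x + s *: e + s *: e') - f (x + s *: e) - (f (x + s *: e') - f x) =
    s ^+ 2 * 'D_e' ('D_e f) (x + a *: e + b *: e')].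
Proof.
move=> fd; have n0 : `|0 : R| <= `|s| by rewrite normr0.
have gd y : derivable f y e -> derivable f (y + s *: e') e ->
    is_derive y e (fun y => f (y + s *: e') - f y) ('D_e f (y + s *: e') - 'D_e f y).
  move=> fy fy'; apply: (@is_deriveB _ _ _ (fun y => f (y + s *: e')) f).
    by apply: is_derive_translate; exact: derivableP.
  exact: derivableP.
have gda a : `|a| <= `|s| -> is_derive (x + a *: e) e
    (fun y => f (y + s *: e') - f y)
    ('D_e f (x + a *: e + s *: e') - 'D_e f (x + a *: e)).
  move=> As; have [fa _] := fd a 0 As n0; have [fs _] := fd a s As (lexx _).
  by rewrite scale0r addr0 in fa; exact: gd fa fs.
have [|a As E] := @mean_value_line (fun y => f (y + s *: e') - f y) x e s.
  by move=> t /gda[].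
have [|b bs E'] := @mean_value_line ('D_e f) (x + a *: e) e' s.
  by move=> b bs; have [] := fd a b As bs.
exists a, b; split => //.
have [_ Ea] := gda a As.
transitivity (s * ('D_e f (x + a *: e + s *: e') - 'D_e f (x + a *: e))).
  by rewrite -Ea -E.
by rewrite E' mulrA.
Qed.

(** Schwarz's theorem. The second difference is symmetric in [e] and [e'], so the two mixed
    derivatives agree at two points arbitrarily close to [x], and continuity concludes. *)
Lemma derive_comm f x e e' :
  (\forall y \near x, derivable f y e) -> (\forall y \near x, derivable f y e') ->
  (\forall y \near x, derivable ('D_e f) y e') ->
  (\forall y \near x, derivable ('D_e' f) y e) ->
  {for x, continuous ('D_e' ('D_e f))} ->
  {for x, continuous ('D_e ('D_e' f))} ->
  'D_e' ('D_e f) x = 'D_e ('D_e' f) x.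
Proof.
move=> d1 d2 d3 d4 /cvgrPdist_le c1 /cvgrPdist_le c2.
apply/eqP; rewrite -subr_eq0 -normr_le0; apply/ler_addgt0Pr => eps eps0.
have hd2 : 0 < eps / 2 by rewrite divr_gt0.
have : \forall y \near x, (derivable f y e /\ derivable ('D_e f) y e') /\
    (derivable f y e' /\ derivable ('D_e' f) y e) /\
    `|'D_e' ('D_e f) x - 'D_e' ('D_e f) y| <= eps / 2 /\
    `|'D_e ('D_e' f) x - 'D_e ('D_e' f) y| <= eps / 2.
  exact: filterI (filterI d1 d3) (filterI (filterI d2 d4)
    (filterI (c1 _ hd2) (c2 _ hd2))).
move/nbhs_ballP => [d /= d0 H].
pose K := `|e| + `|e'| + 1; have K0 : 0 < K by rewrite ltr_wpDl // addr_ge0.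
(* Small enough that the whole parallelogram stays in the ball of radius [d]. *)
pose s := d / 2 / K; have s0 : 0 < s by rewrite !divr_gt0.
have inb a b : `|a| <= `|s| -> `|b| <= `|s| -> ball x d (x + a *: e + b *: e').
  move=> As bs; rewrite -ball_normE /= -addrA opprD addNKr normrN.
  apply: le_lt_trans (ler_normD _ _) _; rewrite !normrZ.
  apply: (@le_lt_trans _ _ (s * K)).
    rewrite /K !mulrDr mulr1; apply: ler_wpDr; first exact: ltW.
    by rewrite (gtr0_norm s0) in As bs; rewrite lerD // ler_wpM2r.
  by rewrite /s divfK ?gt_eqF // ltr_pdivrMr // ltr_pMr // ltr1n.
have [|a [b [As bs E]]] := @mean_value_square f x e e' s.
  by move=> a b As bs; have [] := H _ (inb a b As bs).
have [|a' [b' [As' bs' E']]] := @mean_value_square f x e' e s.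
  move=> a' b' As' bs'; have /H[_ []] := inb b' a' bs' As'.
  by rewrite addrAC.
have EE : 'D_e' ('D_e f) (x + a *: e + b *: e') =
    'D_e ('D_e' f) (x + b' *: e + a' *: e').
  apply: (@mulfI _ (s ^+ 2)); first by rewrite expf_neq0 // gt_eqF.
  rewrite [x + b' *: e + _]addrAC; apply: etrans (esym E) (etrans _ E').
  rewrite [x + s *: e' + _]addrAC.
  move: (f (x + s *: e + s *: e')) (f (x + s *: e)) (f (x + s *: e')) (f x).
  by move=> A B C D; ring.
have [_ [_ [h1 _]]] := H _ (inb a b As bs).
have [_ [_ [_ h2]]] := H _ (inb b' a' bs' As').
rewrite EE in h1; rewrite add0r [eps]splitr.
apply: le_trans (ler_distD ('D_e ('D_e' f) (x + b' *: e + a' *: e')) _ _) _.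
by apply: lerD; [exact: h1|rewrite distrC; exact: h2].
Qed.

End Directional.

(** * Smooth maps on an open set *)

Section Smooth.
Context (R : realType) (m : nat) (U : set 'rV[R]_m).
Hypothesis oU : open U.
Implicit Types (V : normedModType R) (f h : 'rV[R]_m -> R) (x v : 'rV[R]_m).

Lemma near_open x : U x -> \forall y \near x, U y.
Proof. by move=> Ux; apply: open_nbhs_nbhs; split. Qed.

Lemma near_on (P : 'rV[R]_m -> Prop) x : U x -> (forall y, U y -> P y) ->
  \forall y \near x, P y.
Proof. by move=> Ux UP; apply: filterS (near_open Ux). Qed.

Lemma derive_on V (f h : 'rV[R]_m -> V) x v :
  (forall y, U y -> f y = h y) -> U x -> 'D_v f x = 'D_v h x.
Proof. by move=> fh Ux; apply: near_eq_derive; exact: near_on. Qed.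

Lemma derivable_on V (f h : 'rV[R]_m -> V) x v :
  (forall y, U y -> f y = h y) -> U x -> derivable f x v -> derivable h x v.
Proof. by move=> fh Ux; apply: near_eq_derivable; exact: near_on. Qed.

Lemma continuous_on V (f h : 'rV[R]_m -> V) x : (forall y, U y -> f y = h y) ->
  U x -> {for x, continuous f} -> {for x, continuous h}.
Proof.
move=> fh Ux fc; suff : h y @[y --> x] --> h x by []; rewrite -(fh x Ux).
by apply: cvg_trans fc; exact: (near_eq_cvg (near_on Ux fh : {near x, f =1 h})).
Qed.

Lemma Ck_on_cont V k (f : 'rV[R]_m -> V) : Ck_on k U f ->
  forall x, U x -> {for x, continuous f}.
Proof. by case: k => [|k] []. Qed.

Lemma Ck_onW V k (f : 'rV[R]_m -> V) : Ck_on k.+1 U f -> Ck_on k U f.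
Proof.
elim: k f => [|k IH] f [fc fd]; split => // i.
by have [d /IH] := fd i.
Qed.

Lemma Ck_on_ext V k (f h : 'rV[R]_m -> V) :
  (forall y, U y -> f y = h y) -> Ck_on k U f -> Ck_on k U h.
Proof.
elim: k f h => [|k IH] f h fh [fc fd].
  by split=> // x Ux; exact: continuous_on (fc x Ux).
split=> [x Ux|i]; first exact: continuous_on (fc x Ux).
have [d D] := fd i; split=> [x Ux|]; first exact: derivable_on (d x Ux).
by apply: IH D => y Uy; exact: derive_on.
Qed.

Lemma Ck_on_cst V k (c : V) : Ck_on k U (fun=> c).
Proof.
elim: k c => [|k IH] c; split => //; try by move=> x _; exact: (@cst_continuous _ _ c).
move=> i; split=> [x _|]; first exact: (derivable_cst c).
by apply: Ck_on_ext (IH 0) => y _; exact/esym/derive_cst.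
Qed.

Lemma Ck_on_add V k (f h : 'rV[R]_m -> V) :
  Ck_on k U f -> Ck_on k U h -> Ck_on k U (fun y => f y + h y).
Proof.
elim: k f h => [|k IH] f h [fc fd] [hc hd].
  by split=> // x Ux; exact: (cvgD (fc x Ux) (hc x Ux)).
split=> // [x Ux|i]; first by exact: (cvgD (fc x Ux) (hc x Ux)).
have [fi Fi] := fd i; have [hi Hi] := hd i; split=> [x Ux|].
  by apply: derivableD; [exact: fi|exact: hi].
apply: Ck_on_ext (IH _ _ Fi Hi) => y Uy; rewrite deriveD //.
  exact: fi.
exact: hi.
Qed.

Lemma Ck_on_mul k f h :
  Ck_on k U f -> Ck_on k U h -> Ck_on k U (fun y => f y * h y).
Proof.
elim: k f h => [|k IH] f h F H.
  case: F H => fc fd [hc hd].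
  by split=> // x Ux; exact: (cvgM (fc x Ux) (hc x Ux)).
(* The Leibniz rule involves [f] and [h] themselves, so their lower regularity is recorded before
   destructing. *)
have F' := Ck_onW F; have H' := Ck_onW H.
case: F H => fc fd [hc hd]; split=> // [x Ux|i].
  by exact: (cvgM (fc x Ux) (hc x Ux)).
have [fi Fi] := fd i; have [hi Hi] := hd i; split=> [x Ux|].
  by apply: derivableM; [exact: fi|exact: hi].
apply: Ck_on_ext (Ck_on_add (IH _ _ F' Hi) (IH _ _ H' Fi)) => y Uy.
by rewrite deriveM //; [exact: fi|exact: hi].
Qed.

Lemma Ck_on_inv k f : (forall y, U y -> f y != 0) ->
  Ck_on k U f -> Ck_on k U (fun y => (f y)^-1).
Proof.
move=> f0; elim: k => [|k IH] F.
  by case: F => fc fd; split=> // x Ux; exact: (cvgV (f0 x Ux) (fc x Ux)).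
have F' := IH (Ck_onW F); case: F => fc fd; split=> [x Ux|i].
  by exact: (cvgV (f0 x Ux) (fc x Ux)).
have [fi Fi] := fd i; split=> [x Ux|].
  by apply: derivableV; [exact: f0|exact: fi].
have G := Ck_on_mul (@Ck_on_cst R k (-1)) (Ck_on_mul (Ck_on_mul F' F') Fi).
apply: Ck_on_ext G => y Uy; rewrite deriveV; [|exact: f0|exact: fi].
by rewrite mulN1r -exprVn expr2 scaleNr.
Qed.

Lemma smooth_ext V (f h : 'rV[R]_m -> V) :
  (forall y, U y -> f y = h y) -> smooth_on U f -> smooth_on U h.
Proof. by move=> fh F k; apply: Ck_on_ext (F k). Qed.

Lemma smooth_cst V (c : V) : smooth_on U (fun=> c).
Proof. by move=> k; exact: Ck_on_cst. Qed.

Lemma smooth_add V (f h : 'rV[R]_m -> V) :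
  smooth_on U f -> smooth_on U h -> smooth_on U (fun y => f y + h y).
Proof. by move=> F H k; apply: Ck_on_add; [exact: F|exact: H]. Qed.

Lemma smooth_mul f h :
  smooth_on U f -> smooth_on U h -> smooth_on U (fun y => f y * h y).
Proof. by move=> F H k; apply: Ck_on_mul; [exact: F|exact: H]. Qed.

Lemma smooth_inv f : (forall y, U y -> f y != 0) ->
  smooth_on U f -> smooth_on U (fun y => (f y)^-1).
Proof. by move=> f0 F k; apply: Ck_on_inv. Qed.

Lemma smooth_sum V (I : Type) (r : seq I) (P : pred I) (F : I -> 'rV[R]_m -> V) :
  (forall i, P i -> smooth_on U (F i)) ->
  smooth_on U (fun y => \sum_(i <- r | P i) F i y).
Proof.
move=> sF; elim: r => [|i r IH].
  by apply: smooth_ext (smooth_cst 0) => y _; rewrite big_nil.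
case: (boolP (P i)) => Pi.
  by apply: smooth_ext (smooth_add (sF i Pi) IH) => y _; rewrite big_cons Pi.
by apply: smooth_ext IH => y _; rewrite big_cons (negPf Pi).
Qed.

Lemma smooth_prod (I : Type) (r : seq I) (P : pred I) (F : I -> 'rV[R]_m -> R) :
  (forall i, P i -> smooth_on U (F i)) ->
  smooth_on U (fun y => \prod_(i <- r | P i) F i y).
Proof.
move=> sF; elim: r => [|i r IH].
  by apply: smooth_ext (@smooth_cst R 1) => y _; rewrite big_nil.
case: (boolP (P i)) => Pi.
  by apply: smooth_ext (smooth_mul (sF i Pi) IH) => y _; rewrite big_cons Pi.
by apply: smooth_ext IH => y _; rewrite big_cons (negPf Pi).
Qed.

Lemma smooth_cont V (f : 'rV[R]_m -> V) x : smooth_on U f -> U x ->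
  {for x, continuous f}.
Proof. by move=> F; exact: Ck_on_cont (F 0%N) _. Qed.

Lemma smooth_derivable_e V (f : 'rV[R]_m -> V) i x : smooth_on U f -> U x ->
  derivable f x 'e_i.
Proof. by move=> F; have [_ /(_ i)[fd _]] := F 1%N; exact: fd. Qed.

Lemma smooth_derive_e V (f : 'rV[R]_m -> V) i :
  smooth_on U f -> smooth_on U ('D_('e_i) f).
Proof. by move=> F k; have [_ /(_ i)[]] := F k.+1. Qed.

(** [Ck_on] speaks of partial derivatives only; the coordinates of [v] are added one at a time with
    [is_derive_add_dir]. *)
Lemma smooth_is_derive f x v : smooth_on U f -> U x ->
  is_derive x v f (\sum_i v 0 i * 'D_('e_i) f x).
Proof.
move=> F Ux; rewrite [v in is_derive _ v]row_sum_delta.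
elim/big_rec2: _ => [|i L w _ IH]; first exact: is_derive0.
rewrite addrC [_ + L]addrC; apply: is_derive_add_dir => //.
  by apply: near_on => // y Uy; exact: smooth_derivable_e.
by apply: smooth_cont => //; exact: smooth_derive_e.
Qed.

Lemma smooth_derivable f x v : smooth_on U f -> U x -> derivable f x v.
Proof. by move=> F Ux; have [] := smooth_is_derive v F Ux. Qed.

Lemma smooth_deriveE f x v : smooth_on U f -> U x ->
  'D_v f x = \sum_i v 0 i * 'D_('e_i) f x.
Proof. by move=> F Ux; have [_ ->] := smooth_is_derive v F Ux. Qed.

Lemma smooth_derive f v : smooth_on U f -> smooth_on U ('D_v f).
Proof.
move=> F; apply: (@smooth_ext _ (fun y => \sum_i v 0 i * 'D_('e_i) f y)).
  by move=> y Uy; rewrite smooth_deriveE.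
apply: smooth_sum => i _; apply: smooth_mul; first exact: smooth_cst.
exact: smooth_derive_e.
Qed.

Lemma smooth_derive_comm f x u v : smooth_on U f -> U x ->
  'D_u ('D_v f) x = 'D_v ('D_u f) x.
Proof.
move=> F Ux; apply: derive_comm.
- by apply: near_on => // y Uy; exact: smooth_derivable.
- by apply: near_on => // y Uy; exact: smooth_derivable.
- by apply: near_on => // y Uy; apply: smooth_derivable => //; exact: smooth_derive.
- by apply: near_on => // y Uy; apply: smooth_derivable => //; exact: smooth_derive.
- by apply: smooth_cont => //; do 2 apply: smooth_derive.
- by apply: smooth_cont => //; do 2 apply: smooth_derive.
Qed.

(** * Matrix-valued maps *)

Lemma Ck_on_mxP p q k (F : 'rV[R]_m -> 'M[R]_(p, q)) :
  Ck_on k U F <-> forall i j, Ck_on k U (fun y => F y i j).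
Proof.
have comp (G : 'rV[R]_m -> 'M[R]_(p, q)) x : {for x, continuous G} <->
    forall i j, {for x, continuous (fun y => G y i j : R)}.
  split=> [Gc i j|Gc].
    by apply: (@continuous_comp _ _ _ G (fun A : 'M[R]_(p, q) => A i j)) => //;
      exact: coord_continuous.
  suff : G y @[y --> x] --> G x by [].
  apply/(@cvgrPdist_le _ _ _ _ (fmap_filter G (nbhs_filter x))) => /= e e0.
  have H : \forall y \near x, forall ij : 'I_p * 'I_q,
      `|G x ij.1 ij.2 - G y ij.1 ij.2| <= e.
    apply: (@filter_forall _ _ _ (nbhs x) (nbhs_filter x)) => ij.
    exact: ((cvgrPdist_le _ _).1 (Gc ij.1 ij.2)).
  apply: filterS H => y H.
  rewrite /Num.Def.normr /= mx_normrE (bigmax_le _ (ltW e0)) //= => ij _.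
  by rewrite !mxE.
elim: k F => [|k IH] F.
  split=> [[Fc _] i j|Fij]; split=> // x Ux; first exact: (comp F x).1 (Fc x Ux) i j.
  by apply: (comp F x).2 => i j; have [+ _] := Fij i j; apply.
split=> [[Fc Fd] i j|Fij].
  split=> [x Ux|l]; first exact: (comp F x).1 (Fc x Ux) i j.
  have [d D] := Fd l; split=> [x Ux|]; first exact: ((derivable_mxP _ _ _).1 (d x Ux)).
  apply: Ck_on_ext ((IH _).1 D i j) => y Uy.
  by rewrite derive_mx ?mxE //; exact: d.
split=> [x Ux|l]; first by apply: (comp F x).2 => i j; have [+ _] := Fij i j; apply.
have d x : U x -> derivable F x 'e_l.
  by move=> Ux; apply/derivable_mxP => i j; have [_ /(_ l)[+ _]] := Fij i j; apply.
split=> //; apply/IH => i j; have [_ /(_ l)[_ D]] := Fij i j.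
by apply: Ck_on_ext D => y Uy; rewrite derive_mx ?mxE //; exact: d.
Qed.

Lemma smooth_mxP p q (F : 'rV[R]_m -> 'M[R]_(p, q)) :
  smooth_on U F <-> forall i j, smooth_on U (fun y => F y i j).
Proof.
split=> [sF i j k|sF k]; first exact: (Ck_on_mxP _ _).1 (sF k) i j.
by apply/Ck_on_mxP => i j; exact: sF.
Qed.

Lemma smooth_rVP (F : 'rV[R]_m -> 'rV[R]_m) :
  smooth_on U F <-> forall j, smooth_on U (fun y => F y 0 j).
Proof.
split=> [/smooth_mxP sF j|sF]; first exact: sF.
by apply/smooth_mxP => i j; rewrite (ord1 i).
Qed.

Lemma smooth_det p (F : 'rV[R]_m -> 'M[R]_p) :
  smooth_on U F -> smooth_on U (fun y => \det (F y)).
Proof.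
move/smooth_mxP => sF; apply: smooth_sum => s _.
apply: smooth_mul; first exact: smooth_cst.
by apply: smooth_prod => i _; exact: sF.
Qed.

Lemma smooth_invmx p (F : 'rV[R]_m -> 'M[R]_p) :
  (forall y, U y -> F y \in unitmx) -> smooth_on U F ->
  smooth_on U (fun y => invmx (F y)).
Proof.
move=> uF sF; apply/smooth_mxP => i j.
(* Cramer's rule reduces the inverse to determinants, which are polynomial in the entries. *)
apply: (@smooth_ext _ (fun y => (\det (F y))^-1 * cofactor (F y) j i)).
  by move=> y Uy; rewrite /invmx uF // !mxE.
apply: smooth_mul.
  apply: smooth_inv; last exact: smooth_det.
  by move=> y Uy; have := uF y Uy; rewrite unitmxE unitfE.
apply: smooth_mul; first exact: smooth_cst.
apply: smooth_det; apply/smooth_mxP => k l; have /smooth_mxP sF' := sF.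
by apply: (@smooth_ext _ (fun y => F y (lift j k) (lift i l))) => // y _; rewrite !mxE.
Qed.

Lemma smooth_mx_derivable p q (F : 'rV[R]_m -> 'M[R]_(p, q)) x v :
  smooth_on U F -> U x -> derivable F x v.
Proof.
move=> /smooth_mxP sF Ux; apply/derivable_mxP => i j.
exact: smooth_derivable (sF i j) Ux.
Qed.

Lemma derive_mxE p q (F : 'rV[R]_m -> 'M[R]_(p, q)) x v i j :
  smooth_on U F -> U x -> ('D_v F x) i j = 'D_v (fun y => F y i j) x.
Proof. by move=> sF Ux; rewrite derive_mx ?mxE //; exact: smooth_mx_derivable. Qed.

Lemma smooth_mx_deriveE p q (F : 'rV[R]_m -> 'M[R]_(p, q)) x v :
  smooth_on U F -> U x -> 'D_v F x = \sum_i v 0 i *: 'D_('e_i) F x.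
Proof.
move=> sF Ux; apply/matrixP => i j; have /smooth_mxP sF' := sF.
rewrite derive_mxE // (smooth_deriveE v (sF' i j) Ux) summxE.
by apply: eq_bigr => k _; rewrite mxE derive_mxE.
Qed.

Lemma smooth_mx_derive p q (F : 'rV[R]_m -> 'M[R]_(p, q)) v :
  smooth_on U F -> smooth_on U ('D_v F).
Proof.
move=> sF; apply/smooth_mxP => i j; have /smooth_mxP sF' := sF.
apply: smooth_ext (smooth_derive v (sF' i j)) => y Uy.
by rewrite derive_mxE.
Qed.

Lemma smooth_scale p q f (F : 'rV[R]_m -> 'M[R]_(p, q)) :
  smooth_on U f -> smooth_on U F -> smooth_on U (fun y => f y *: F y).
Proof.
move=> sf /smooth_mxP sF; apply/smooth_mxP => i j.
by apply: smooth_ext (smooth_mul sf (sF i j)) => y _; rewrite mxE.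
Qed.

Lemma smooth_mulmx p q r (F : 'rV[R]_m -> 'M[R]_(p, q))
    (H : 'rV[R]_m -> 'M[R]_(q, r)) :
  smooth_on U F -> smooth_on U H -> smooth_on U (fun y => F y *m H y).
Proof.
move=> /smooth_mxP sF /smooth_mxP sH; apply/smooth_mxP => i j.
apply: (@smooth_ext _ (fun y => \sum_k F y i k * H y k j)).
  by move=> y _; rewrite mxE.
by apply: smooth_sum => k _; apply: smooth_mul.
Qed.

Lemma smooth_trmx p q (F : 'rV[R]_m -> 'M[R]_(p, q)) :
  smooth_on U F -> smooth_on U (fun y => (F y)^T).
Proof.
move=> /smooth_mxP sF; apply/smooth_mxP => i j.
by apply: smooth_ext (sF j i) => y _; rewrite mxE.
Qed.

Lemma derive_mul f h x v : smooth_on U f -> smooth_on U h -> U x ->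
  'D_v (fun y => f y * h y) x = 'D_v f x * h x + f x * 'D_v h x.
Proof.
move=> sf sh Ux; rewrite (deriveM (smooth_derivable sf Ux) (smooth_derivable sh Ux)).
by rewrite addrC [_ *: 'D_v f x]mulrC.
Qed.

Lemma derive_bigsum n (F : 'I_n -> 'rV[R]_m -> R) x v :
  (forall i, smooth_on U (F i)) -> U x ->
  'D_v (fun y => \sum_i F i y) x = \sum_i 'D_v (F i) x.
Proof.
move=> sF Ux.
have -> : (fun y => \sum_i F i y) = \sum_i F i by apply/funext => y; rewrite fct_sumE.
by rewrite derive_sum // => i; exact: smooth_derivable.
Qed.

Lemma derive_mulmx p q r (F : 'rV[R]_m -> 'M[R]_(p, q))
    (H : 'rV[R]_m -> 'M[R]_(q, r)) x v :
  smooth_on U F -> smooth_on U H -> U x ->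
  'D_v (fun y => F y *m H y) x = 'D_v F x *m H x + F x *m 'D_v H x.
Proof.
move=> sF sH Ux; have /smooth_mxP sF' := sF; have /smooth_mxP sH' := sH.
apply/matrixP => i j; rewrite derive_mxE //; last exact: smooth_mulmx.
rewrite (_ : (fun y => (F y *m H y) i j) = fun y => \sum_k F y i k * H y k j).
  rewrite derive_bigsum // => [|k]; last by apply: smooth_mul.
  rewrite !mxE -big_split; apply: eq_bigr => k _ /=.
  by rewrite derive_mul // !derive_mxE.
by apply/funext => y; rewrite mxE.
Qed.

Lemma derive_trmx p q (F : 'rV[R]_m -> 'M[R]_(p, q)) x v :
  smooth_on U F -> U x -> 'D_v (fun y => (F y)^T) x = ('D_v F x)^T.
Proof.
move=> sF Ux; apply/matrixP => i j.
rewrite mxE !derive_mxE //; last exact: smooth_trmx.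
by apply: derive_on => // y _; rewrite mxE.
Qed.

Lemma derive_scale p q f (F : 'rV[R]_m -> 'M[R]_(p, q)) x v :
  smooth_on U f -> smooth_on U F -> U x ->
  'D_v (fun y => f y *: F y) x = 'D_v f x *: F x + f x *: 'D_v F x.
Proof.
move=> sf sF Ux; have /smooth_mxP sF' := sF.
apply/matrixP => i j; rewrite derive_mxE //; last exact: smooth_scale.
rewrite (derive_on (h := fun y => f y * F y i j)) // => [|y _]; last by rewrite mxE.
by rewrite derive_mul // !mxE derive_mxE.
Qed.

End Smooth.

(** * Algebra at a point *)

Section Pointwise.
Context (R : realFieldType) (V : lmodType R) (G : V -> V -> R) (J : V -> V).
Context (eps : R) (xi zeta : V).
Implicit Types u v w z : V.

Hypothesis GDl : forall u v w, G (u + v) w = G u w + G v w.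
Hypothesis GZl : forall c u w, G (c *: u) w = c * G u w.
Hypothesis GC : forall u v, G u v = G v u.
Hypothesis G_nondeg : forall u, (forall w, G u w = 0) -> u = 0.
Hypothesis JD : forall u v, J (u + v) = J u + J v.
Hypothesis JZ : forall c u, J (c *: u) = c *: J u.
Hypothesis GJ : forall u v, G (J u) v = - G u (J v).
Hypothesis JJ : forall u, J (J u) = eps *: u.
Hypothesis eps1 : eps = -1 \/ eps = 1.
Hypothesis q0 : G xi xi != 0.

Lemma GDr u v w : G w (u + v) = G w u + G w v.
Proof. by rewrite GC GDl !(GC w). Qed.
Lemma GZr c u w : G w (c *: u) = c * G w u.
Proof. by rewrite GC GZl !(GC w). Qed.
Lemma GNl u w : G (- u) w = - G u w.
Proof. by rewrite -scaleN1r GZl mulN1r. Qed.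
Lemma GNr u w : G w (- u) = - G w u.
Proof. by rewrite GC GNl GC. Qed.
Lemma G0l u : G 0 u = 0.
Proof. by rewrite -(scale0r u) GZl mul0r. Qed.
Lemma JN u : J (- u) = - J u.
Proof. by rewrite -scaleN1r JZ scaleN1r. Qed.
Lemma GJC u v : G u (J v) = - G v (J u).
Proof. by rewrite GC GJ. Qed.
Lemma GJJ u v : G u (J (J v)) = eps * G u v.
Proof. by rewrite JJ GZr. Qed.
Lemma GJself u : G u (J u) = 0.
Proof. by have := GJC u u; lra. Qed.

Definition Gexp := (GDl, GDr, GNl, GNr, GZl, GZr, JD, JN, JZ, GJ, GJJ).

Definition linear_part u v : V := G u v *: xi - G xi v *: u
  + (eps * G u (J v)) *: J xi - (eps * G xi (J v)) *: J u.

Definition Slin u v : V := linear_part u v - (2 * G zeta (J u)) *: J v.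

(* The last sign comes from [G (J xi) (J xi) = - eps * G xi xi]. *)
Definition perp u : V :=
  u - (G u xi / G xi xi) *: xi + (eps * G u (J xi) / G xi xi) *: J xi.

Lemma perp_xi u : G (perp u) xi = 0.
Proof. by rewrite /perp !Gexp GJself (GC u); field. Qed.

Lemma perp_Jxi u : G (perp u) (J xi) = 0.
Proof.
rewrite /perp !Gexp GJself; case: eps1 => ->; by field.
Qed.

Lemma G_perp u v : G u xi = 0 -> G u (J xi) = 0 -> G u (perp v) = G u v.
Proof. by move=> h1 h2; rewrite /perp !Gexp h1 h2; ring. Qed.

(** The form in which the dimension enters: [xi] and [J xi] do not span. [exists_perp_neq0] provides
    it. *)
Hypothesis perp_neq0 : exists u, perp u != 0.

(** The signature is arbitrary, so a nonzero orthogonal vector may be null. Nondegeneracy then gives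
    a second one pairing nontrivially with it, and if both are null their sum is not, by
    polarisation. *)
Lemma ex_nonnull_perp : exists w, [/\ G w w != 0, G w xi = 0 & G w (J xi) = 0].
Proof.
have [u u0] := perp_neq0.
have [u1|u1] := eqVneq (G (perp u) (perp u)) 0; last first.
  by exists (perp u); rewrite perp_xi perp_Jxi.
have [v v1] : exists v, G (perp u) v != 0.
  apply: contrapT => /forallNP H; move/eqP: u0; apply; apply: G_nondeg => w.
  exact: contrapT (H w \o (introN eqP)).
have [v2|v2] := eqVneq (G (perp v) (perp v)) 0; last first.
  by exists (perp v); rewrite perp_xi perp_Jxi.
exists (perp u + perp v); split; rewrite GDl ?perp_xi ?perp_Jxi ?addr0 //.
rewrite !(GDr (perp u) (perp v)) u1 v2 add0r addr0 (GC (perp v)).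
rewrite G_perp ?perp_xi ?perp_Jxi //.
by rewrite -mulr2n mulrn_eq0.
Qed.

(** A linear-type tensor determines its two vectors; it will be applied to the derivatives of [xi]
    and [zeta]. *)
Lemma Slin_inj al be :
  (forall y z, G y z *: al - G al z *: y + (eps * G y (J z)) *: J al
     - (eps * G al (J z)) *: J y - (2 * G be (J y)) *: J z = 0) ->
  al = 0 /\ be = 0.
Proof.
move=> H; have [w [w0 wxi wJxi]] := ex_nonnull_perp.
(* [H y y] puts [al] in the span of [y] and [J y]; the planes of [xi] and [w]  *)
(* meet only in 0.                                                            *)
have orth y p : G y y != 0 -> G y p = 0 -> G y (J p) = 0 -> G al p = 0.
  move=> y0 yp yJp; have := congr1 (G p) (H y y).
  rewrite !Gexp !GJself (GC p y) yp (GJC p y) yJp (GC p al) -(scale0r p) GZr.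
  move=> E; apply: (mulfI y0); rewrite mulr0; move: E; lra.
have al0 : al = 0.
  apply: G_nondeg => v.
  have h1 : G al (perp v) = 0.
    by apply: (orth xi) => //; [rewrite GC perp_xi|rewrite GJC perp_Jxi oppr0].
  have h2 : G al xi = 0.
    by apply: (orth w).
  have h3 : G al (J xi) = 0.
    by apply: (orth w) => //; rewrite GJJ wxi mulr0.
  by rewrite -[RHS]h1 /perp !Gexp h2 h3; ring.
split=> //; apply: G_nondeg => v.
(* With [y = eps *: J v] one has [J y = v], so only [G be v] times
   [G (J xi) (J xi) = - eps * G xi xi] is left. *)
have := congr1 (G (J xi)) (H (eps *: J v) xi).
rewrite al0 -(scale0r v) !Gexp => E; apply: (mulfI q0); rewrite mulr0.
by move: E; case: eps1 => ->; lra.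
Qed.

(** * Algebraic curvature tensors of Kähler type *)

Context (T : V -> V -> V -> V -> R).
Hypothesis TDl : forall u u' v w z, T (u + u') v w z = T u v w z + T u' v w z.
Hypothesis TZl : forall c u v w z, T (c *: u) v w z = c * T u v w z.
Hypothesis T12 : forall u v w z, T v u w z = - T u v w z.
Hypothesis T34 : forall u v w z, T u v z w = - T u v w z.
Hypothesis Tbianchi : forall u v w z, T u v w z + T v w u z + T w u v z = 0.
Hypothesis TJ : forall u v w z, T u v (J w) z = - T u v w (J z).

(** The usual linear combination of the four cyclic identities on [u], [v], [w], [z]. *)
Lemma Tpair u v w z : T u v w z = T w z u v.
Proof.
have := Tbianchi u v w z; have := Tbianchi v w z u.
have := Tbianchi w z u v; have := Tbianchi z u v w.
have [[[[]]]] := (T34 v w u z, T34 w z u v, T12 v z w u, T12 z u v w, T34 u v w z).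
have [[[]]] := (T34 v z w u, T12 w u z v, T34 w u v z, T34 z u v w).
lra.
Qed.

Lemma TJ12 u v w z : T (J u) (J v) w z = - eps * T u v w z.
Proof. by rewrite Tpair TJ JJ Tpair T12 TZl T12; ring. Qed.

Hypothesis Txi : forall u v w, T u v xi w =
  G (Slin u (Slin v xi) - Slin v (Slin u xi) - Slin (Slin u v - Slin v u) xi) w.

Lemma TxiE x y z : let a u := G xi u in let b u := G u (J xi) in
  let lam u := -2 * G zeta (J u) in
  let q := G xi xi in
  T x y xi z = q * (a x * G y z - a y * G x z - eps * b x * G y (J z)
     + eps * b y * G x (J z) - 2 * eps * G x (J y) * G xi (J z))
   - q * (lam x * G y (J z) - lam y * G x (J z))
   + (lam x * b y - lam y * b x) * a z + (lam x * a y - lam y * a x) * b z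
   - (- a y * lam x + a x * lam y + 2 * eps * G x (J y) * lam (J xi)
     + eps * b y * lam (J x) - eps * b x * lam (J y) + lam x * lam (J y)
     - lam y * lam (J x)) * b z.
Proof.
move=> a b lam q; rewrite Txi /Slin /linear_part !Gexp !GJself.
rewrite ?(GC x xi) ?(GC y xi) ?(GC z xi) ?(GJC x xi) ?(GJC y xi) ?(GJC z xi).
rewrite ?(GC y x) ?(GJC y x) /q /a /b /lam ?(GJC x xi) ?(GJC y xi) ?(GJC z xi) !Gexp.
by case: eps1 => ->; ring.
Qed.

Lemma zeta_eq0 : zeta = 0.
Proof.
have [w [w0 wxi wJxi]] := ex_nonnull_perp.
have xiw : G xi w = 0 by rewrite GC.
have xiJw : G xi (J w) = 0 by rewrite GJC wJxi oppr0.
have q2 : G xi xi * G w w != 0 by rewrite mulf_neq0.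
(* For [w] orthogonal to [xi] and [J xi], pairing [TJ12] with [J w] isolates [lam xi], and pairing
   it with [w] isolates [lam (J xi)]. *)
have lam0 : G zeta (J xi) = 0.
  have := TJ12 xi w xi (J w); rewrite !TxiE !Gexp !GJself xiw xiJw wxi wJxi => E.
  apply: (mulfI q2); rewrite mulr0; move: E; case: eps1 => ->; lra.
have lam1 : G zeta xi = 0.
  have := TJ12 xi w xi w; rewrite !TxiE !Gexp !GJself xiw xiJw wxi wJxi => E.
  apply: (mulfI q2); rewrite mulr0; move: E; case: eps1 => ->; lra.
apply: G_nondeg => x.
(* As [lam] vanishes on [xi] and [J xi], [zeta] survives on the left side only, through
   [lam (J x) = -2 * eps * G zeta x], with a nonzero multiple of [G xi xi ^+ 2] as coefficient;
   hence the two cancellations. *)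
have := Tpair xi (J x) xi (J xi).
rewrite !TxiE !Gexp !GJself lam0 lam1 (GC x xi) (GJC x xi) => E.
apply: (mulfI q0); apply: (mulfI q0); rewrite !mulr0; move: E; case: eps1 => ->; lra.
Qed.

(** The curvature tensor of constant [eps]-holomorphic sectional curvature 4. *)
Definition hol_form x y z w := G y z * G x w - G x z * G y w
  + eps * G x (J z) * G y (J w) - eps * G x (J w) * G y (J z)
  + 2 * eps * G x (J y) * G z (J w).

Hypothesis Tcyc : forall k i j p r,
  T (Slin k i) j p r + T i (Slin k j) p r + T i j (Slin k p) r + T i j p (Slin k r)
  + (T (Slin i j) k p r + T j (Slin i k) p r + T j k (Slin i p) r + T j k p (Slin i r))
  + (T (Slin j k) i p r + T k (Slin j i) p r + T k i (Slin j p) r + T k i p (Slin j r))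
  = 0.

Lemma T_hol_form x y z w : T x y z w = - G xi xi * hol_form x y z w.
Proof.
have K1 u v t : T xi t u v = G xi xi * (G xi u * G v t - G xi v * G u t
    + eps * G xi (J u) * G v (J t) - eps * G xi (J v) * G u (J t)
    - 2 * eps * G u (J v) * G xi (J t)).
  by rewrite Tpair TxiE zeta_eq0 !G0l (GJC u xi) (GJC v xi); ring.
have K2 u v t : T (J xi) t u v = - T xi (J t) u v.
  by rewrite Tpair TJ Tpair.
have S0 u : Slin xi u = 0.
  rewrite /Slin /linear_part zeta_eq0 G0l mulr0 scale0r subr0.
  by rewrite subrr add0r subrr.
have Sxi u : Slin u xi = G xi u *: xi - G xi xi *: u - (eps * G xi (J u)) *: J xi.
  rewrite /Slin /linear_part zeta_eq0 G0l mulr0 scale0r subr0.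
  by rewrite GJself mulr0 scale0r subr0 (GC u) GJC mulrN scaleNr.
have T0 u v t : T 0 u v t = 0 by rewrite -(scale0r xi) TZl mul0r.
have TN t u v p : T (- u) v t p = - T u v t p by rewrite -scaleN1r TZl mulN1r.
have GS u v t : G (Slin u v) t = G u v * G xi t - G xi v * G u t
    - eps * G u (J v) * G xi (J t) + eps * G xi (J v) * G u (J t).
  by rewrite /Slin /linear_part zeta_eq0 G0l !Gexp; ring.
have GSr u v t : G t (Slin u v) = G u v * G xi t - G xi v * G u t
    - eps * G u (J v) * G xi (J t) + eps * G xi (J v) * G u (J t).
  by rewrite GC GS.
have GSJ u v t : G t (J (Slin u v)) = - (G u v * G xi (J t) - G xi v * G u (J t)
    - eps * G u (J v) * (eps * G xi t) + eps * G xi (J v) * (eps * G u t)).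
  by rewrite GJC GS !GJJ.
(* [S0] kills the group differentiated along [xi]. By [Sxi], each of the other two contains
   [G xi xi * T x y z w]; every remaining term has [xi] or [J xi] in the first pair and is given by
   [K1] and [K2]. *)
have := Tcyc xi x y z w.
rewrite !S0 !Sxi (T12 0 x) (Tpair x y 0) (Tpair x y z) (T12 0 z) !T0.
rewrite (T12 xi (Slin x y)) !(T12 xi y) !K1.
rewrite (T12 (_ + _) y) !(TDl, TN, TZl) !K2 !K1 (T12 x y).
rewrite !GS !GSr !GSJ !Gexp !GJself.
rewrite ?(GJC x xi) ?(GJC y xi) ?(GJC z xi) ?(GJC w xi).
rewrite ?(GC y x) ?(GJC y x) ?(GC z x) ?(GJC z x) ?(GC z y) ?(GJC z y).
rewrite ?(GC w x) ?(GJC w x) ?(GC w y) ?(GJC w y) ?(GC w z) ?(GJC w z).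
rewrite ?(GC x xi) ?(GC y xi) ?(GC z xi) ?(GC w xi).
rewrite /hol_form => E; apply: (mulfI q0); move: E; case: eps1 => ->; lra.
Qed.

End Pointwise.

(** * The Levi-Civita connection and its curvature *)

Section Bilin.
Context (R : realType) (m : nat) (G : 'M[R]_m).
Implicit Types u v w : 'rV[R]_m.

Lemma bilinDl u v w : bilin G (u + v) w = bilin G u w + bilin G v w.
Proof. by rewrite /bilin !mulmxDl mxE. Qed.
Lemma bilinDr u v w : bilin G w (u + v) = bilin G w u + bilin G w v.
Proof. by rewrite /bilin linearD mulmxDr mxE. Qed.
Lemma bilinZl c u w : bilin G (c *: u) w = c * bilin G u w.
Proof. by rewrite /bilin -!scalemxAl mxE. Qed.
Lemma bilinZr c u w : bilin G w (c *: u) = c * bilin G w u.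
Proof. by rewrite /bilin linearZ -scalemxAr mxE. Qed.
Lemma bilinBl u v w : bilin G (u - v) w = bilin G u w - bilin G v w.
Proof. by rewrite bilinDl -scaleN1r bilinZl mulN1r. Qed.
Lemma bilinBr u v w : bilin G w (u - v) = bilin G w u - bilin G w v.
Proof. by rewrite bilinDr -scaleN1r bilinZr mulN1r. Qed.
Lemma bilinC u w : G^T = G -> bilin G u w = bilin G w u.
Proof.
move=> Gs; rewrite /bilin.
transitivity ((w *m G *m u^T)^T 0 0); last by rewrite mxE.
by rewrite !trmx_mul trmxK Gs mulmxA.
Qed.
Lemma bilin_nondeg u : G \in unitmx -> (forall w, bilin G u w = 0) -> u = 0.
Proof.
move=> Gu u0; suff uG : u *m G = 0 by rewrite -(mulmxK Gu u) uG mul0mx.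
apply/rowP => j; have := u0 (delta_mx 0 j).
by rewrite /bilin trmx_delta -colE !mxE.
Qed.

End Bilin.

Section Connection.
Context (R : realType) (m : nat) (M : manifold R m) (g : metric M).
Variable a : atlas_index M.
Local Notation U := (cod (atlas a)).
Implicit Types (x u v w : 'rV[R]_m) (X Y Z W : 'rV[R]_m -> 'rV[R]_m).
Implicit Types f : 'rV[R]_m -> R.

Let oU : open U := @cod_open _ _ _ (atlas a).

Lemma smooth_inner X Y : smooth_on U X -> smooth_on U Y ->
  smooth_on U (fun y => inner g a y (X y) (Y y)).
Proof.
move=> sX sY.
have := smooth_mulmx oU (smooth_mulmx oU sX (gram_smooth g a)) (smooth_trmx oU sY).
by move/smooth_mxP => /(_ oU 0 0).
Qed.

Lemma smooth_christoffel i j k : smooth_on U (fun y => christoffel g a y i j k).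
Proof.
have gs p q : smooth_on U (fun y => gram g a y p q).
  by have /smooth_mxP := gram_smooth g a; apply.
have is_ : smooth_on U (fun y => invmx (gram g a y)).
  by apply: smooth_invmx => //; [exact: gram_unit|exact: gram_smooth].
apply: smooth_mul => //; first exact: smooth_cst.
apply: smooth_sum => // l _; apply: smooth_mul => //; last first.
  by move/smooth_mxP : is_; apply.
have dg r p q : smooth_on U (fun y => dgram g a y r p q).
  exact: smooth_derive_e (gs p q).
apply: (smooth_ext oU (f := fun y => dgram g a y i j l + dgram g a y j i l +
  -1 * dgram g a y l i j)).
  by move=> y _; rewrite mulN1r.
apply: smooth_add => //; first exact: smooth_add.
by apply: smooth_mul => //; exact: smooth_cst.
Qed.

(** The connection form of the chart evaluated on [v], acting on rows from the right. *)
Definition connection_mx v x : 'M[R]_m :=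
  \matrix_(j, k) \sum_i v 0 i * christoffel g a x i j k.

Lemma connection_mxD u v x :
  connection_mx (u + v) x = connection_mx u x + connection_mx v x.
Proof.
apply/matrixP => j k; rewrite !mxE -big_split; apply: eq_bigr => i _.
by rewrite !mxE mulrDl.
Qed.

Lemma connection_mxZ c v x : connection_mx (c *: v) x = c *: connection_mx v x.
Proof.
apply/matrixP => j k; rewrite !mxE mulr_sumr; apply: eq_bigr => i _.
by rewrite !mxE mulrA.
Qed.

Lemma smooth_connection_mx X : smooth_on U X ->
  smooth_on U (fun y => connection_mx (X y) y).
Proof.
move=> /(smooth_rVP oU) sX; apply/(smooth_mxP oU) => j k.
apply: (smooth_ext oU (f := fun y => \sum_i X y 0 i * christoffel g a y i j k)).
  by move=> y _; rewrite mxE.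
apply: smooth_sum => // i _; apply: smooth_mul => //.
exact: smooth_christoffel.
Qed.

Definition nab v Y x : 'rV[R]_m := levi_civita g a (fun=> v) Y x.

Lemma nabE v Y x : nab v Y x = 'D_v Y x + Y x *m connection_mx v x.
Proof.
rewrite /nab /levi_civita /dirder; congr (_ + _); apply/rowP => k.
rewrite !mxE exchange_big; apply: eq_bigr => j _; rewrite !mxE mulr_sumr.
by apply: eq_bigr => i _; rewrite [RHS]mulrCA mulrA.
Qed.

Lemma levi_civitaE X Y x : levi_civita g a X Y x = nab (X x) Y x.
Proof. by []. Qed.

(* [nab] unfolds to a sum, which sends rewriting with additivity lemmas astray. *)
Local Opaque nab.

Lemma nabD v Y Z x : smooth_on U Y -> smooth_on U Z -> U x ->
  nab v (fun y => Y y + Z y) x = nab v Y x + nab v Z x.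
Proof.
move=> sY sZ Ux; have dY : derivable Y x v by apply: (smooth_mx_derivable oU).
have dZ : derivable Z x v by apply: (smooth_mx_derivable oU).
by rewrite !nabE (deriveD dY dZ) mulmxDl addrACA.
Qed.

Lemma nab_scale v f Y x : smooth_on U f -> smooth_on U Y -> U x ->
  nab v (fun y => f y *: Y y) x = 'D_v f x *: Y x + f x *: nab v Y x.
Proof.
move=> sf sY Ux; rewrite !nabE (derive_scale oU) // -scalemxAl scalerDr.
by rewrite addrA.
Qed.

Lemma nab_on v Y Z x : (forall y, U y -> Y y = Z y) -> U x ->
  nab v Y x = nab v Z x.
Proof. by move=> YZ Ux; rewrite !nabE (derive_on oU v YZ Ux) YZ. Qed.

Lemma nab0 v x : nab v (fun=> 0) x = 0.
Proof. by rewrite nabE mul0mx addr0 (derive_cst 0). Qed.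

Lemma nab_sum v n (F : 'I_n -> 'rV[R]_m -> 'rV[R]_m) x :
  (forall i, smooth_on U (F i)) -> U x ->
  nab v (fun y => \sum_i F i y) x = \sum_i nab v (F i) x.
Proof.
move=> sF Ux; elim: n F sF => [|n IH] F sF.
  rewrite big_ord0 -[RHS](nab0 v x); apply: nab_on => // y _.
  by rewrite big_ord0.
rewrite big_ord_recl -IH // -nabD //; last by apply: smooth_sum.
by apply: nab_on => // y _; rewrite big_ord_recl.
Qed.

Lemma nab_dir v Y x : smooth_on U Y -> U x ->
  nab v Y x = \sum_i v 0 i *: nab 'e_i Y x.
Proof.
move=> sY Ux; rewrite nabE (smooth_mx_deriveE oU v sY Ux).
have -> : connection_mx v x = \sum_i v 0 i *: connection_mx 'e_i x.
  rewrite {1}(row_sum_delta v); elim/big_rec2: _ => [|i A w _ IH].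
    by rewrite -(scale0r 0) connection_mxZ scale0r.
  by rewrite connection_mxD connection_mxZ IH.
rewrite mulmx_sumr -big_split; apply: eq_bigr => i _ /=.
by rewrite nabE scalerDr scalemxAr.
Qed.

Lemma nabDdir u v Y x : smooth_on U Y -> U x ->
  nab (u + v) Y x = nab u Y x + nab v Y x.
Proof.
move=> sY Ux; rewrite !(nab_dir _ sY Ux) -big_split; apply: eq_bigr => i _.
by rewrite mxE scalerDl.
Qed.

Lemma nabZdir c v Y x : smooth_on U Y -> U x -> nab (c *: v) Y x = c *: nab v Y x.
Proof.
move=> sY Ux; rewrite !(nab_dir _ sY Ux) scaler_sumr; apply: eq_bigr => i _.
by rewrite mxE scalerA.
Qed.

Lemma nabBdir u v Y x : smooth_on U Y -> U x ->
  nab (u - v) Y x = nab u Y x - nab v Y x.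
Proof.
by move=> sY Ux; rewrite -[in LHS]scaleN1r nabDdir // nabZdir // scaleN1r.
Qed.

Lemma smooth_nab v Y : smooth_on U Y -> smooth_on U (nab v Y).
Proof.
move=> sY; apply: (smooth_ext oU
  (f := fun y => 'D_v Y y + Y y *m connection_mx v y)).
  by move=> y _; rewrite nabE.
apply: smooth_add => //; first exact: smooth_mx_derive.
apply: smooth_mulmx => //; apply: (smooth_connection_mx (X := fun=> v)).
exact: smooth_cst.
Qed.

Lemma nab_torsion_free u v x : U x -> nab u (fun=> v) x = nab v (fun=> u) x.
Proof.
move=> Ux; have := levi_civita_torsion_free g (fun=> u) (fun=> v) Ux.
rewrite /lie_bracket /dirder (derive_cst v) (derive_cst u) subrr.
by move/eqP; rewrite subr_eq0 => /eqP.
Qed.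

(** Extends [christoffel_metric] from coordinate fields to all fields; [dG] is its matrix form. *)
Lemma nab_metric v Y Z x : smooth_on U Y -> smooth_on U Z -> U x ->
  'D_v (fun y => inner g a y (Y y) (Z y)) x =
  inner g a x (nab v Y x) (Z x) + inner g a x (Y x) (nab v Z x).
Proof.
move=> sY sZ Ux; have sG := gram_smooth g a.
have dG : 'D_v (gram g a) x = connection_mx v x *m gram g a x +
    gram g a x *m (connection_mx v x)^T.
  rewrite (smooth_mx_deriveE oU v sG Ux); apply/matrixP => i j.
  rewrite summxE !mxE.
  transitivity (\sum_k v 0 k * dgram g a x k i j).
    by apply: eq_bigr => k _; rewrite mxE (derive_mxE oU).
  under eq_bigr do rewrite (christoffel_metric _ _ _ _ Ux) mulrDr !mulr_sumr.
  rewrite big_split; congr (_ + _); rewrite exchange_big; apply: eq_bigr => l _ /=.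
    by rewrite !mxE mulr_suml; apply: eq_bigr => k _; rewrite mulrA.
  by rewrite !mxE mulr_sumr; apply: eq_bigr => k _; rewrite [LHS]mulrA [LHS]mulrC.
have -> : 'D_v (fun y => inner g a y (Y y) (Z y)) x =
    ('D_v (fun y => Y y *m gram g a y *m (Z y)^T) x) 0 0.
  by rewrite (derive_mxE oU) //; do !apply: smooth_mulmx => //; exact: smooth_trmx.
rewrite (derive_mulmx oU) //; [|exact: smooth_mulmx|exact: smooth_trmx].
rewrite (derive_mulmx oU) // (derive_trmx oU) // dG !nabE.
rewrite /inner bilinDl bilinDr /bilin linearD /= trmx_mul.
rewrite !(mulmxDl, mulmxDr) !mulmxA !mxE; ring.
Qed.

(** The directions [u] and [v] stand for constant fields, whose bracket is zero. *)
Definition curv u v Z x : 'rV[R]_m := nab u (nab v Z) x - nab v (nab u Z) x.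

Lemma smooth_curv u v Z : smooth_on U Z -> smooth_on U (curv u v Z).
Proof.
move=> sZ; apply: (smooth_ext oU (f := fun y => nab u (nab v Z) y +
    (-1 : R) *: nab v (nab u Z) y)).
  by move=> y _; rewrite scaleN1r.
apply: smooth_add => //; first by do 2 apply: smooth_nab.
by apply: smooth_scale => //; [exact: smooth_cst|do 2 apply: smooth_nab].
Qed.

(** Separates the variation of the direction field [Y]. In [curvatureE] the resulting first terms
    cancel the bracket term. *)
Lemma nab_levi_civita u Y Z x : smooth_on U Y -> smooth_on U Z -> U x ->
  nab u (levi_civita g a Y Z) x = nab ('D_u Y x) Z x + nab u (nab (Y x) Z) x.
Proof.
move=> sY sZ Ux; have /(smooth_rVP oU) sY' := sY.
rewrite (@nab_on u _ (fun y => \sum_i Y y 0 i *: nab 'e_i Z y) x) //; last first.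
  by move=> y Uy; rewrite levi_civitaE nab_dir.
rewrite nab_sum //; last first.
  by move=> i; apply: smooth_scale => //; exact: smooth_nab.
rewrite (nab_dir _ sZ) //.
rewrite (@nab_on u _ (fun y => \sum_i Y x 0 i *: nab 'e_i Z y) x) //; last first.
  by move=> y Uy; rewrite nab_dir.
rewrite (nab_sum u (F := fun i y => Y x 0 i *: nab 'e_i Z y)) //; last first.
  by move=> i; apply: smooth_scale => //; [exact: smooth_cst|exact: smooth_nab].
rewrite -big_split; apply: eq_bigr => i _ /=.
have sni := smooth_nab 'e_i sZ.
rewrite nab_scale // (nab_scale u (f := fun=> Y x 0 i)) //; last exact: smooth_cst.
by rewrite (derive_cst (Y x 0 i)) scale0r add0r (derive_mxE oU).
Qed.

Lemma curvatureE X Y Z x :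
  smooth_on U X -> smooth_on U Y -> smooth_on U Z -> U x ->
  curvature g a X Y Z x = curv (X x) (Y x) Z x.
Proof.
move=> sX sY sZ Ux; rewrite /curvature.
rewrite [levi_civita g a X _ x]levi_civitaE (nab_levi_civita (X x) sY sZ Ux).
rewrite [levi_civita g a Y _ x]levi_civitaE (nab_levi_civita (Y x) sX sZ Ux).
rewrite [levi_civita g a _ Z x]levi_civitaE /lie_bracket /dirder.
rewrite (nabBdir _ _ sZ Ux) /curv.
rewrite [X in X - _ = _](_ : _ = (nab ('D_(X x) Y x) Z x - nab ('D_(Y x) X x) Z x) +
  (nab (X x) (nab (Y x) Z) x - nab (Y x) (nab (X x) Z) x)).
  by rewrite addrC addKr.
by rewrite opprD addrACA.
Qed.

Let sc v : smooth_on U (fun=> v : 'rV[R]_m).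
Proof. exact: smooth_cst. Qed.
Let sn := smooth_nab.

Lemma nabB v Y Z x : smooth_on U Y -> smooth_on U Z -> U x ->
  nab v (fun y => Y y - Z y) x = nab v Y x - nab v Z x.
Proof.
move=> sY sZ Ux.
have sm : smooth_on U (fun=> -1 : R) by apply: smooth_cst.
rewrite (@nab_on v _ (fun y => Y y + -1 *: Z y) x) //; last first.
  by move=> y _; rewrite scaleN1r.
rewrite nabD //; last exact: smooth_scale.
by rewrite (nab_scale v (f := fun=> -1)) // (derive_cst (-1 : R)) scale0r add0r scaleN1r.
Qed.

Lemma curv_on u v Y Z x : (forall y, U y -> Y y = Z y) -> U x ->
  curv u v Y x = curv u v Z x.
Proof.
move=> YZ Ux; rewrite /curv.
by congr (_ - _); apply: nab_on => // y Uy; apply: nab_on.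
Qed.

Lemma curvD u v Y Z x : smooth_on U Y -> smooth_on U Z -> U x ->
  curv u v (fun y => Y y + Z y) x = curv u v Y x + curv u v Z x.
Proof.
move=> sY sZ Ux; rewrite /curv.
have E p q : nab p (nab q (fun y => Y y + Z y)) x =
    nab p (nab q Y) x + nab p (nab q Z) x.
  rewrite -nabD //; [|exact: sn|exact: sn].
  by apply: nab_on => // y Uy; rewrite nabD.
by rewrite (E u v) (E v u) opprD addrACA.
Qed.

(** The terms with first derivatives of [f] are symmetric in the two directions, and so is the
    second derivative of [f]. *)
Lemma curv_scale u v f Z x : smooth_on U f -> smooth_on U Z -> U x ->
  curv u v (fun y => f y *: Z y) x = f x *: curv u v Z x.
Proof.
move=> sf sZ Ux; rewrite /curv.
have E p q : nab p (nab q (fun y => f y *: Z y)) x =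
    'D_p ('D_q f) x *: Z x + f x *: nab p (nab q Z) x
    + ('D_q f x *: nab p Z x + 'D_p f x *: nab q Z x).
  have sDf := smooth_derive oU q sf; have snZ := sn q sZ.
  rewrite (@nab_on p _ (fun y => 'D_q f y *: Z y + f y *: nab q Z y)) //.
    rewrite nabD //; [|exact: smooth_scale|exact: smooth_scale].
    by rewrite !nab_scale // [RHS]addrAC -!addrA [_ + (_ + _)]addrCA.
  by move=> y Uy; rewrite nab_scale.
rewrite (E u v) (E v u) (smooth_derive_comm oU u v sf Ux) scalerBr.
rewrite ['D_v f x *: _ + _]addrC opprD addrACA subrr addr0.
by rewrite opprD addrACA subrr add0r.
Qed.

Lemma curv_sum u v n (F : 'I_n -> 'rV[R]_m -> 'rV[R]_m) x :
  (forall i, smooth_on U (F i)) -> U x ->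
  curv u v (fun y => \sum_i F i y) x = \sum_i curv u v (F i) x.
Proof.
move=> sF Ux; elim: n F sF => [|n IH] F sF.
  rewrite big_ord0 (@curv_on _ _ _ (fun y => (0 : R) *: 0) x) //.
    by rewrite (@curv_scale _ _ (fun=> 0) (fun=> 0)) ?scale0r //; exact: smooth_cst.
  by move=> y _; rewrite big_ord0 scale0r.
rewrite big_ord_recl -IH // -curvD //; last by apply: smooth_sum.
by apply: curv_on => // y _; rewrite big_ord_recl.
Qed.

(** In the expansion of [Z] in the coordinate frame, only the values of the coefficients at [x]
    count. *)
Lemma curv_tensor u v Z x : smooth_on U Z -> U x ->
  curv u v Z x = curv u v (fun=> Z x) x.
Proof.
move=> sZ Ux; have /(smooth_rVP oU) sZ' := sZ.
have sK (c : R) : smooth_on U (fun=> c) by apply: smooth_cst.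
have E (c : 'I_m -> 'rV[R]_m -> R) : (forall i, smooth_on U (c i)) ->
    curv u v (fun y => \sum_i c i y *: 'e_i) x =
    \sum_i c i x *: curv u v (fun=> 'e_i) x.
  move=> sK'; have sce i : smooth_on U (fun y => c i y *: 'e_i : 'rV[R]_m).
    by apply: smooth_scale.
  transitivity (\sum_i curv u v (fun y => c i y *: 'e_i) x).
    exact: (curv_sum u v sce Ux).
  by apply: eq_bigr => i _; exact: (curv_scale u v (sK' i) (sc 'e_i) Ux).
transitivity (curv u v (fun y => \sum_i Z y 0 i *: 'e_i) x).
  by apply: curv_on Ux => y _; exact: row_sum_delta.
transitivity (curv u v (fun y => \sum_i Z x 0 i *: 'e_i) x); last first.
  by apply: curv_on Ux => y _; apply/esym; exact: row_sum_delta.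
exact: etrans (E _ sZ') (esym (E (fun i y => Z x 0 i) (fun i => sK _))).
Qed.

Lemma curv_anti u v Z x : curv v u Z x = - curv u v Z x.
Proof. by rewrite /curv opprB. Qed.

Lemma curvDdir u u' v Z x : smooth_on U Z -> U x ->
  curv (u + u') v Z x = curv u v Z x + curv u' v Z x.
Proof.
move=> sZ Ux; rewrite /curv nabDdir //; last exact: sn.
rewrite (@nab_on v _ (fun y => nab u Z y + nab u' Z y)) //; last first.
  by move=> y Uy; rewrite nabDdir.
by rewrite nabD //; [rewrite opprD addrACA|exact: sn|exact: sn].
Qed.

Lemma curvZdir c u v Z x : smooth_on U Z -> U x ->
  curv (c *: u) v Z x = c *: curv u v Z x.
Proof.
move=> sZ Ux; rewrite /curv nabZdir //; last exact: sn.
rewrite (@nab_on v _ (fun y => c *: nab u Z y)) //; last first.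
  by move=> y Uy; rewrite nabZdir.
have sK : smooth_on U (fun=> c) by apply: smooth_cst.
rewrite (nab_scale v (f := fun=> c)) //; last exact: sn.
by rewrite (derive_cst c) scale0r add0r scalerBr.
Qed.

(** Second derivatives of [g(w,z)] commute, and the cross terms given by metric compatibility are
    symmetric in [u] and [v]. *)
Lemma curv_skew u v w z x : U x ->
  inner g a x (curv u v (fun=> w) x) z = - inner g a x w (curv u v (fun=> z) x).
Proof.
move=> Ux; pose h y := inner g a y w z.
have sh : smooth_on U h by exact: (smooth_inner (sc w) (sc z)).
have E p q : 'D_p ('D_q h) x =
    inner g a x (nab p (nab q (fun=> w)) x) z + inner g a x w (nab p (nab q (fun=> z)) x)
    + (inner g a x (nab q (fun=> w) x) (nab p (fun=> z) x)
     + inner g a x (nab p (fun=> w) x) (nab q (fun=> z) x)).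
  rewrite (derive_on oU (h := fun y => inner g a y (nab q (fun=> w) y) z +
    inner g a y w (nab q (fun=> z) y))) //; last first.
    by move=> y Uy; exact: (nab_metric q (sc w) (sc z) Uy).
  have s1 := smooth_inner (sn q (sc w)) (sc z).
  have s2 := smooth_inner (sc w) (sn q (sc z)).
  rewrite (deriveD (smooth_derivable oU s1 Ux) (smooth_derivable oU s2 Ux)).
  rewrite (nab_metric p (sn q (sc w)) (sc z) Ux) (nab_metric p (sc w) (sn q (sc z)) Ux).
  ring.
have := etrans (esym (E u v)) (etrans (smooth_derive_comm oU u v sh Ux) (E v u)).
by rewrite /curv /inner bilinBl bilinBr; lra.
Qed.

Lemma curv_bianchi u v w x : U x ->
  curv u v (fun=> w) x + curv v w (fun=> u) x + curv w u (fun=> v) x = 0.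
Proof.
move=> Ux; rewrite /curv.
have E p q r : nab p (nab q (fun=> r)) x = nab p (nab r (fun=> q)) x.
  by apply: nab_on => // y Uy; exact: nab_torsion_free.
rewrite (E v u w) (E w v u) (E u w v).
by rewrite subrKA subrKA subrr.
Qed.

(** The Jacobi identity for the operators [nab u], [nab v], [nab w]. *)
Lemma second_bianchi u v w Z x : smooth_on U Z -> U x ->
  (nab u (curv v w Z) x - curv v w (nab u Z) x)
  + (nab v (curv w u Z) x - curv w u (nab v Z) x)
  + (nab w (curv u v Z) x - curv u v (nab w Z) x) = 0.
Proof.
move=> sZ Ux.
have E p q r : nab p (curv q r Z) x =
    nab p (nab q (nab r Z)) x - nab p (nab r (nab q Z)) x.
  by rewrite -nabB //; do 2 apply: sn.
rewrite (E u v w) (E v w u) (E w u v) /curv.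
move: (nab u (nab v (nab w Z)) x) (nab u (nab w (nab v Z)) x) => A A'.
move: (nab v (nab w (nab u Z)) x) (nab v (nab u (nab w Z)) x) => B B'.
move: (nab w (nab u (nab v Z)) x) (nab w (nab v (nab u Z)) x) => C C'.
by apply/rowP => i; rewrite !mxE; ring.
Qed.

Lemma smooth_endo (J : endo_field M) Y : smooth_on U Y ->
  smooth_on U (fun y => endo J a y (Y y)).
Proof. by move=> sY; apply: smooth_mulmx => //; exact: endo_smooth. Qed.

Lemma smooth_t12 (S : tensor12 M) X Y : smooth_on U X -> smooth_on U Y ->
  smooth_on U (fun y => t12 S a y (X y) (Y y)).
Proof.
move=> /(smooth_rVP oU) sX sY; apply: smooth_sum => // i _.
apply: smooth_scale => //; apply: smooth_mulmx => //; exact: t12_smooth.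
Qed.

Lemma curv_endo (J : endo_field M) eps u v Z x : eps_kahler eps g J ->
  smooth_on U Z -> U x ->
  curv u v (fun y => endo J a y (Z y)) x = endo J a x (curv u v Z x).
Proof.
move=> [_ kJ] sZ Ux.
have kJ' p Y y : smooth_on U Y -> U y ->
    nab p (fun y => endo J a y (Y y)) y = endo J a y (nab p Y y).
  by move=> sY Uy; exact: (kJ a (fun=> p) Y (sc p) sY y Uy).
have E p q : nab p (nab q (fun y => endo J a y (Z y))) x =
    endo J a x (nab p (nab q Z) x).
  rewrite -kJ' //; last exact: sn.
  by apply: nab_on => // y Uy; exact: kJ'.
by rewrite /curv (E u v) (E v u) /endo /app_mx mulmxBl.
Qed.

End Connection.

(** * Homogeneous structures of linear type *)

(** Otherwise every row of the identity matrix would be a combination of [xi] and [J xi], and its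
    rank at most 2. *)
Lemma exists_perp_neq0 (R : realFieldType) m (G : 'rV[R]_m -> 'rV[R]_m -> R)
    (J : 'rV[R]_m -> 'rV[R]_m) eps xi : (2 < m)%N ->
  exists u, perp G J eps xi u != 0.
Proof.
move=> m2; apply: contrapT => /forallNP H.
suff : (1%:M <= col_mx xi (J xi))%MS.
  move/mxrankS; rewrite mxrank1 => /leq_trans/(_ (rank_leq_row _)).
  by rewrite leqNgt m2.
apply/row_subP => i; set u := row i _.
have /negP/negPn/eqP u0 := H u.
have -> : u = (G u xi / G xi xi) *: xi - (eps * G u (J xi) / G xi xi) *: J xi.
  apply/eqP; rewrite -subr_eq0 opprB [_ *: J xi - _]addrC addrA; exact/eqP.
rewrite -addsmxE -scaleNr.
by apply: addmx_sub_adds; apply: scalemx_sub.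
Qed.

Section Tensor.
Context (R : realType) (m : nat) (M : manifold R m) (S : tensor12 M).
Variables (a : atlas_index M) (x : 'rV[R]_m).
Implicit Types u v w : 'rV[R]_m.

Lemma t12Dl u v w : t12 S a x (u + v) w = t12 S a x u w + t12 S a x v w.
Proof.
by rewrite /t12 /app_mx2 -big_split; apply: eq_bigr => i _; rewrite mxE scalerDl.
Qed.

Lemma t12Zl c u w : t12 S a x (c *: u) w = c *: t12 S a x u w.
Proof.
by rewrite /t12 /app_mx2 scaler_sumr; apply: eq_bigr => i _; rewrite mxE scalerA.
Qed.

Lemma t12Dr u v w : t12 S a x w (u + v) = t12 S a x w u + t12 S a x w v.
Proof.
rewrite /t12 /app_mx2 -big_split; apply: eq_bigr => i _.
by rewrite /app_mx mulmxDl scalerDr.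
Qed.

Lemma t12Zr c u w : t12 S a x w (c *: u) = c *: t12 S a x w u.
Proof.
rewrite /t12 /app_mx2 scaler_sumr; apply: eq_bigr => i _.
by rewrite /app_mx -scalemxAl scalerA mulrC -scalerA.
Qed.

End Tensor.

Section LinearType.
Context (R : realType) (m : nat) (M : manifold R m) (g : metric M).
Context (J : endo_field M) (S : tensor12 M) (xi zeta : vector_field M) (eps : R).
Variable a : atlas_index M.
Local Notation U := (cod (atlas a)).
Implicit Types (x u v w : 'rV[R]_m) (X Y Z W : 'rV[R]_m -> 'rV[R]_m).
Implicit Types f : 'rV[R]_m -> R.

Hypothesis eps1 : eps = -1 \/ eps = 1.
Hypothesis m4 : (4 <= m)%N.
Hypothesis kahlerJ : eps_kahler eps g J.
Hypothesis homS : homogeneous_eps_kahler g J S.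
Hypothesis linS : linear_type eps g J S xi zeta.
Hypothesis nondeg : non_degenerate g xi.

Local Notation nab := (@nab R m M g a).
Local Notation Rm := (@curv R m M g a).
Local Notation inn := (@inner R m M g a).
Local Notation JJ := (@endo R m M J a).
Local Notation SS := (@t12 R m M S a).

Let oU : open U := @cod_open _ _ _ (atlas a).
Let sc v : smooth_on U (fun=> v : 'rV[R]_m).
Proof. exact: smooth_cst. Qed.
Let sxi : smooth_on U (xi a) := @vf_smooth _ _ _ xi a.
Let szeta : smooth_on U (zeta a) := @vf_smooth _ _ _ zeta a.

Definition nabt v Y x := nab v Y x - SS x v (Y x).

Lemma nablatE X Y x : nablat g S a X Y x = nabt (X x) Y x.
Proof. by []. Qed.

Lemma nabt_on v Y Z x : (forall y, U y -> Y y = Z y) -> U x ->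
  nabt v Y x = nabt v Z x.
Proof. by move=> YZ Ux; rewrite /nabt (nab_on g v YZ Ux) YZ. Qed.

Lemma nabtD v Y Z x : smooth_on U Y -> smooth_on U Z -> U x ->
  nabt v (fun y => Y y + Z y) x = nabt v Y x + nabt v Z x.
Proof.
by move=> sY sZ Ux; rewrite /nabt (nabD g v sY sZ Ux) t12Dr opprD addrACA.
Qed.

Lemma nabt_scale v f Y x : smooth_on U f -> smooth_on U Y -> U x ->
  nabt v (fun y => f y *: Y y) x = 'D_v f x *: Y x + f x *: nabt v Y x.
Proof.
move=> sf sY Ux; rewrite /nabt (nab_scale g v sf sY Ux) t12Zr.
by rewrite scalerBr addrA.
Qed.

Lemma nabt_metric v Y Z x : smooth_on U Y -> smooth_on U Z -> U x ->
  'D_v (fun y => inn y (Y y) (Z y)) x =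
  inn x (nabt v Y x) (Z x) + inn x (Y x) (nabt v Z x).
Proof.
by case: homS => + _ _ _; move=> /(_ a (fun=> v) Y Z (sc v)) H sY sZ Ux; exact: H.
Qed.

Lemma nabt_J v Y x : smooth_on U Y -> U x ->
  nabt v (fun y => JJ y (Y y)) x = JJ x (nabt v Y x).
Proof.
by case: homS => _ _ _ /(_ a (fun=> v) Y (sc v)) H sY Ux; exact: H.
Qed.

Lemma nabt_S v Y Z x : smooth_on U Y -> smooth_on U Z -> U x ->
  nabt v (fun y => SS y (Y y) (Z y)) x =
  SS x (nabt v Y x) (Z x) + SS x (Y x) (nabt v Z x).
Proof.
by case: homS => _ _ /(_ a (fun=> v) Y Z (sc v)) H _ sY sZ Ux; exact: H.
Qed.

Lemma t12E x u v : U x ->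
  SS x u v = Slin (inn x) (JJ x) eps (xi a x) (zeta a x) u v.
Proof. by move=> Ux; exact: linS. Qed.

Lemma innDl x u v w : inn x (u + v) w = inn x u w + inn x v w.
Proof. exact: bilinDl. Qed.
Lemma innBl x u v w : inn x (u - v) w = inn x u w - inn x v w.
Proof. exact: bilinBl. Qed.
Lemma innZl x c u w : inn x (c *: u) w = c * inn x u w.
Proof. exact: bilinZl. Qed.
Lemma innC x : U x -> forall u v, inn x u v = inn x v u.
Proof. by move=> Ux u v; apply: bilinC; exact: gram_sym. Qed.
Lemma inn_nondeg x : U x -> forall u, (forall w, inn x u w = 0) -> u = 0.
Proof. by move=> Ux u; apply: bilin_nondeg; exact: gram_unit. Qed.
Lemma JD x u v : JJ x (u + v) = JJ x u + JJ x v.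
Proof. exact: mulmxDl. Qed.
Lemma JZ x c u : JJ x (c *: u) = c *: JJ x u.
Proof. by rewrite /endo /app_mx scalemxAl. Qed.
Lemma innJ x : U x -> forall u v, inn x (JJ x u) v = - inn x u (JJ x v).
Proof. by move=> Ux u v; case: kahlerJ => /(_ a x Ux)[]. Qed.
Lemma JJeps x : U x -> forall u, JJ x (JJ x u) = eps *: u.
Proof. by move=> Ux u; case: kahlerJ => /(_ a x Ux)[]. Qed.

Lemma smooth_inn_scale (c : R) A B Y : smooth_on U A -> smooth_on U B ->
  smooth_on U Y -> smooth_on U (fun y => (c * inn y (A y) (B y)) *: Y y).
Proof.
move=> sA sB sY; apply: smooth_scale => //; apply: smooth_mul => //.
  exact: smooth_cst.
exact: smooth_inner.
Qed.

Lemma nabt_inn_scale v (c : R) A B Y x : smooth_on U A -> smooth_on U B ->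
  smooth_on U Y -> U x ->
  nabt v (fun y => (c * inn y (A y) (B y)) *: Y y) x =
  (c * (inn x (nabt v A x) (B x) + inn x (A x) (nabt v B x))) *: Y x
  + (c * inn x (A x) (B x)) *: nabt v Y x.
Proof.
move=> sA sB sY Ux; have sAB := smooth_inner g sA sB.
have sK : smooth_on U (fun=> c) by apply: smooth_cst.
rewrite (nabt_scale v (smooth_mul oU sK sAB) sY Ux).
rewrite (derive_mul oU v sK sAB Ux) (derive_cst c) mul0r add0r.
by rewrite (nabt_metric v sA sB Ux).
Qed.

(* Since [nabt] kills [g], [J] and [S], differentiating the linear form of [S] *)
(* leaves the same form with [nabt xi] and [nabt zeta] in place of [xi], [zeta]. *)
Lemma nabt_xi_zeta v x : U x -> nabt v (xi a) x = 0 /\ nabt v (zeta a) x = 0.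
Proof.
move=> Ux.
have sJ Y : smooth_on U Y -> smooth_on U (fun y => JJ y (Y y)).
  exact: smooth_endo.
have P := @exists_perp_neq0 R m (inn x) (JJ x) eps (xi a x) (ltnW m4).
apply: (Slin_inj (@innDl x) (@innZl x) (innC Ux) (inn_nondeg Ux) (@JD x) (@JZ x)
  (innJ Ux) (JJeps Ux) eps1 (nondeg Ux) P) => u w.
have := nabt_S v (sc u) (sc w) Ux.
(* The explicit 1 and -1 give all five terms the shape expected by [nabt_inn_scale]. *)
pose F y := (1 * inn y u w) *: xi a y + (-1 * inn y (xi a y) w) *: u
  + (eps * inn y u (JJ y w)) *: JJ y (xi a y)
  + (- eps * inn y (xi a y) (JJ y w)) *: JJ y u
  + (-2 * inn y (zeta a y) (JJ y u)) *: JJ y w.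
have -> : nabt v (fun y => SS y u w) x = nabt v F x.
  apply: nabt_on Ux => y Uy; rewrite t12E // /Slin /linear_part /F.
  by rewrite mul1r mulN1r !mulNr !scaleNr.
have s1 := smooth_inn_scale 1 (sc u) (sc w) sxi.
have s2 := smooth_inn_scale (-1) sxi (sc w) (sc u).
have s3 := smooth_inn_scale eps (sc u) (sJ _ (sc w)) (sJ _ sxi).
have s4 := smooth_inn_scale (- eps) sxi (sJ _ (sc w)) (sJ _ (sc u)).
have s5 := smooth_inn_scale (-2) szeta (sJ _ (sc u)) (sJ _ (sc w)).
have s12 := smooth_add oU s1 s2; have s13 := smooth_add oU s12 s3.
have s14 := smooth_add oU s13 s4.
rewrite /F (nabtD v s14 s5 Ux) (nabtD v s13 s4 Ux) (nabtD v s12 s3 Ux).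
rewrite (nabtD v s1 s2 Ux).
rewrite (nabt_inn_scale v 1 (sc u) (sc w) sxi Ux).
rewrite (nabt_inn_scale v (-1) sxi (sc w) (sc u) Ux).
rewrite (nabt_inn_scale v eps (sc u) (sJ _ (sc w)) (sJ _ sxi) Ux).
rewrite (nabt_inn_scale v (- eps) sxi (sJ _ (sc w)) (sJ _ (sc u)) Ux).
rewrite (nabt_inn_scale v (-2) szeta (sJ _ (sc u)) (sJ _ (sc w)) Ux).
rewrite (nabt_J v (sc w) Ux) (nabt_J v (sc u) Ux) (nabt_J v sxi Ux).
rewrite !t12E // /Slin /linear_part.
(* The terms in the derivatives of [u] and [w] match the right side; what remains is the linear form
   in [al] and [be]. *)
move: (nabt v (xi a) x) (nabt v (zeta a) x) (nabt v (fun=> u) x) (nabt v (fun=> w) x).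
move=> al be p r.
move: (JJ x (xi a x)) (JJ x al) (JJ x p) (JJ x r) (JJ x u) (JJ x w).
move=> Jxi Jal Jp Jr Ju Jw.
move: (xi a x) (zeta a x) => X Z.
move: (inn x) => G E; apply/rowP => i; have := congr1 (fun V : 'rV[R]_m => V 0 i) E.
rewrite !mxE; lra.
Qed.

Lemma derive_inn_xi v x : U x -> 'D_v (fun y => inn y (xi a y) (xi a y)) x = 0.
Proof.
move=> Ux; rewrite (nabt_metric v sxi sxi Ux); have [-> _] := nabt_xi_zeta v Ux.
by rewrite -(scale0r (xi a x)) (innC Ux (xi a x)) innZl mul0r addr0.
Qed.

Lemma smooth_nabt v Y : smooth_on U Y -> smooth_on U (nabt v Y).
Proof.
move=> sY; have sm : smooth_on U (fun=> -1 : R) by apply: smooth_cst.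
apply: (smooth_ext oU (f := fun y => nab v Y y + -1 *: SS y v (Y y))).
  by move=> y _; rewrite scaleN1r.
apply: smooth_add => //; first exact: smooth_nab.
by apply: smooth_scale => //; exact: (smooth_t12 S (sc v) sY).
Qed.

Lemma nab_nabt v Y x : nab v Y x = nabt v Y x + SS x v (Y x).
Proof. by rewrite /nabt subrK. Qed.

Lemma t12Bl x u v w : SS x (u - v) w = SS x u w - SS x v w.
Proof. by rewrite t12Dl -scaleN1r t12Zl scaleN1r. Qed.

(** Parallelism gives [nab q xi = S q xi]; one more derivative falls only on the argument [q] of
    [S], as [nab p q - S p q], and torsion-freeness removes the [nab] parts from the commutator. *)
Lemma curv_xi u v x : U x -> Rm u v (xi a) x =
  SS x u (SS x v (xi a x)) - SS x v (SS x u (xi a x))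
  - SS x (SS x u v - SS x v u) (xi a x).
Proof.
move=> Ux.
have E p q : nab p (nab q (xi a)) x =
    SS x (nab p (fun=> q) x - SS x p q) (xi a x) + SS x p (SS x q (xi a x)).
  have -> : nab p (nab q (xi a)) x = nab p (fun y => SS y q (xi a y)) x.
    apply: (nab_on g p _ Ux) => y Uy.
    by rewrite nab_nabt; have [-> _] := nabt_xi_zeta q Uy; rewrite add0r.
  rewrite nab_nabt (nabt_S p (sc q) sxi Ux); have [-> _] := nabt_xi_zeta p Ux.
  by rewrite -(scale0r (xi a x)) t12Zr scale0r addr0.
rewrite /curv (E u v) (E v u) (nab_torsion_free g u v Ux) !t12Bl.
move: (SS x (nab v (fun=> u) x) (xi a x)) (SS x (SS x u v) (xi a x)) => A B.
move: (SS x (SS x v u) (xi a x)) (SS x u (SS x v (xi a x))) => C D.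
by move: (SS x v (SS x u (xi a x))) => E'; apply/rowP => i; rewrite !mxE; ring.
Qed.

(** * The curvature as a (0,4)-tensor *)

Definition curv4 x u v w z := inn x (Rm u v (fun=> w) x) z.

Lemma riemE X Y Z W x : smooth_on U X -> smooth_on U Y -> smooth_on U Z -> U x ->
  riem g a X Y Z W x = curv4 x (X x) (Y x) (Z x) (W x).
Proof.
by move=> sX sY sZ Ux; rewrite /riem (curvatureE g sX sY sZ Ux) curv_tensor.
Qed.

Lemma curv4Dl x : U x -> forall u u' v w z,
  curv4 x (u + u') v w z = curv4 x u v w z + curv4 x u' v w z.
Proof.
by move=> Ux u u' v w z; rewrite /curv4 (curvDdir g u u' v (sc w) Ux) innDl.
Qed.
Lemma curv4Zl x : U x -> forall c u v w z,
  curv4 x (c *: u) v w z = c * curv4 x u v w z.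
Proof. by move=> Ux c u v w z; rewrite /curv4 (curvZdir g c u v (sc w) Ux) innZl. Qed.
Lemma curv4_12 x : forall u v w z, curv4 x v u w z = - curv4 x u v w z.
Proof. by move=> u v w z; rewrite /curv4 curv_anti -scaleN1r innZl mulN1r. Qed.
Lemma curv4_34 x : U x -> forall u v w z, curv4 x u v z w = - curv4 x u v w z.
Proof. by move=> Ux u v w z; rewrite /curv4 (curv_skew g u v z w Ux) innC. Qed.
Lemma curv4_bianchi x : U x -> forall u v w z,
  curv4 x u v w z + curv4 x v w u z + curv4 x w u v z = 0.
Proof.
move=> Ux u v w z; rewrite /curv4 -!innDl (curv_bianchi g u v w Ux).
by rewrite -(scale0r 0) innZl mul0r.
Qed.
Lemma curv4_J x : U x -> forall u v w z,
  curv4 x u v (JJ x w) z = - curv4 x u v w (JJ x z).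
Proof.
move=> Ux u v w z; rewrite /curv4 -(innJ Ux) -(curv_endo u v kahlerJ (sc w) Ux).
by rewrite [in RHS](curv_tensor g u v (smooth_endo J (sc w)) Ux).
Qed.
Lemma curv4_xi x : U x -> forall u v w,
  let S' := Slin (inn x) (JJ x) eps (xi a x) (zeta a x) in
  curv4 x u v (xi a x) w =
  inn x (S' u (S' v (xi a x)) - S' v (S' u (xi a x)) - S' (S' u v - S' v u) (xi a x)) w.
Proof.
move=> Ux u v w S'.
by rewrite /curv4 -(curv_tensor g u v sxi Ux) (curv_xi u v Ux) !t12E.
Qed.

Lemma curv4D4 x u v w z z' :
  curv4 x u v w (z + z') = curv4 x u v w z + curv4 x u v w z'.
Proof. exact: bilinDr. Qed.
Lemma curv4D3 x : U x -> forall u v w w' z,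
  curv4 x u v (w + w') z = curv4 x u v w z + curv4 x u v w' z.
Proof.
by move=> Ux u v w w' z; rewrite !(curv4_34 Ux u v z) curv4D4 opprD.
Qed.
Lemma curv4D2 x : U x -> forall u v v' w z,
  curv4 x u (v + v') w z = curv4 x u v w z + curv4 x u v' w z.
Proof.
by move=> Ux u v v' w z; rewrite !(curv4_12 x _ u) curv4Dl // opprD.
Qed.

(** The summand of [second_bianchi]: the derivative of [R(i,j)p] along [k], from which the terms
    differentiating [i] and [j] are not subtracted. *)
Definition dcurv k i j p x :=
  nab k (Rm i j (fun=> p)) x - Rm i j (nab k (fun=> p)) x.

Lemma curv4_derive x k i j p r : U x ->
  inn x (dcurv k i j p x) r =
  curv4 x (nab k (fun=> i) x) j p r + curv4 x i (nab k (fun=> j) x) p r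
  - (curv4 x (SS x k i) j p r + curv4 x i (SS x k j) p r
     + curv4 x i j (SS x k p) r + curv4 x i j p (SS x k r)).
Proof.
move=> Ux; have [_ + _ _] := homS.
move=> /(_ a _ _ _ _ _ (sc k) (sc i) (sc j) (sc p) (sc r) x Ux).
have snt q := smooth_nabt k (sc q).
rewrite (riemE _ (snt i) (sc j) (sc p) Ux) (riemE _ (sc i) (snt j) (sc p) Ux).
rewrite (riemE _ (sc i) (sc j) (snt p) Ux) (riemE _ (sc i) (sc j) (sc p) Ux).
rewrite !nablatE.
have -> : dirder (fun=> k) (riem g a (fun=> i) (fun=> j) (fun=> p) (fun=> r)) x =
    inn x (nab k (Rm i j (fun=> p)) x) r + curv4 x i j p (nab k (fun=> r) x).
  rewrite -(nab_metric g k (smooth_curv g i j (sc p)) (sc r) Ux).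
  apply: (derive_on oU k _ Ux) => y Uy.
  exact: (riemE (fun=> r) (sc i) (sc j) (sc p) Uy).
rewrite /dcurv innBl (curv_tensor g i j (smooth_nab g k (sc p)) Ux).
rewrite -/(curv4 x i j (nab k (fun=> p) x) r) !nab_nabt.
rewrite (curv4Dl Ux) (curv4D2 Ux) (curv4D3 Ux) curv4D4.
move: (curv4 x) (inn x _ r) => T D.
move: (nabt k (fun=> i) x) (nabt k (fun=> j) x) (nabt k (fun=> p) x) => A B C.
move: (nabt k (fun=> r) x) (SS x k i) (SS x k j) (SS x k p) (SS x k r).
by move=> F A' B' C' F'; lra.
Qed.

(** Sums [curv4_derive] cyclically; the terms that differentiate [i], [j], [k] cancel in pairs by
    torsion-freeness and skewness. *)
Lemma curv4_cyclic x k i j p r : U x ->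
  let S' := Slin (inn x) (JJ x) eps (xi a x) (zeta a x) in
  curv4 x (S' k i) j p r + curv4 x i (S' k j) p r
   + curv4 x i j (S' k p) r + curv4 x i j p (S' k r)
  + (curv4 x (S' i j) k p r + curv4 x j (S' i k) p r
   + curv4 x j k (S' i p) r + curv4 x j k p (S' i r))
  + (curv4 x (S' j k) i p r + curv4 x k (S' j i) p r
   + curv4 x k i (S' j p) r + curv4 x k i p (S' j r)) = 0.
Proof.
move=> Ux S'.
have B : dcurv k i j p x + dcurv i j k p x + dcurv j k i p x = 0.
  exact: (second_bianchi g k i j (sc p) Ux).
have : inn x (dcurv k i j p x + dcurv i j k p x + dcurv j k i p x) r = 0.
  by rewrite B -(scale0r r) innZl mul0r.
rewrite (innDl x (_ + _)) (innDl x (dcurv _ _ _ _ _)) !(curv4_derive _ _ _ _ _ Ux).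
rewrite !(t12E _ _ Ux) -/S' {B}.
rewrite (nab_torsion_free g j k Ux) (nab_torsion_free g j i Ux).
rewrite (nab_torsion_free g i k Ux).
move: (nab k (fun=> i) x) (nab k (fun=> j) x) (nab i (fun=> j) x) => A B' C.
rewrite (curv4_12 x A j) (curv4_12 x B' i) (curv4_12 x C k).
clearbody S'; move: (curv4 x) => T; lra.
Qed.

Lemma zeta_zero_curv4 x : U x -> zeta a x = 0 /\
  forall u v w z, curv4 x u v w z =
    - inn x (xi a x) (xi a x) * hol_form (inn x) (JJ x) eps u v w z.
Proof.
move=> Ux; have P := @exists_perp_neq0 R m (inn x) (JJ x) eps (xi a x) (ltnW m4).
split.
  exact: (zeta_eq0 (@innDl x) (@innZl x) (innC Ux) (inn_nondeg Ux) (@JD x) (@JZ x)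
    (innJ Ux) (JJeps Ux) eps1 (nondeg Ux) P (curv4Zl Ux) (curv4_12 x) (curv4_34 Ux)
    (curv4_bianchi Ux) (curv4_J Ux) (curv4_xi Ux)).
move=> u v w z.
exact: (T_hol_form (@innDl x) (@innZl x) (innC Ux) (inn_nondeg Ux) (@JD x) (@JZ x)
    (innJ Ux) (JJeps Ux) eps1 (nondeg Ux) P (curv4Dl Ux) (curv4Zl Ux) (curv4_12 x)
    (curv4_34 Ux) (curv4_bianchi Ux) (curv4_J Ux) (curv4_xi Ux)
    (fun k i j p r => curv4_cyclic k i j p r Ux)).
Qed.

Lemma constant_hol_curvature_at X Y Z W x : smooth_on U X -> smooth_on U Y ->
  smooth_on U Z -> U x -> riem g a X Y Z W x =
  - inn x (xi a x) (xi a x) * hol_form (inn x) (JJ x) eps (X x) (Y x) (Z x) (W x).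
Proof.
move=> sX sY sZ Ux; rewrite riemE //.
by have [_ ->] := zeta_zero_curv4 Ux.
Qed.

End LinearType.

(** * From charts to the manifold *)

Lemma near_eq_of_derive0 (R : realType) m (U : set 'rV[R]_m) (f : 'rV[R]_m -> R) x :
  open U -> smooth_on U f -> (forall y v, U y -> 'D_v f y = 0) -> U x ->
  \forall y \near x, U y /\ f y = f x.
Proof.
move=> oU sf f0 Ux; have /nbhs_ballP[e /= e0 eU] := near_open oU Ux.
apply/nbhs_ballP; exists e => // y xy; split; first exact: eU.
have inU (t : R) : `|t| <= `|1 : R| -> U (x + t *: (y - x)).
  rewrite normr1 => t1; apply: eU; rewrite -ball_normE /= opprD addNKr normrN normrZ.
  move: xy; rewrite -ball_normE /= distrC; apply: le_lt_trans.
  by rewrite -[leRHS]mul1r ler_wpM2r.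
have [|c /inU Uc] := @mean_value_line R _ f x (y - x) 1.
  by move=> t /inU; exact: (smooth_derivable oU).
by rewrite scale1r [x + _]addrC subrK f0 // mulr0 => /eqP; rewrite subr_eq0 => /eqP.
Qed.

(** The points where the function takes a given value form an open set with open complement. *)
Lemma chart_constant (R : realType) m (M : manifold R m)
    (f : atlas_index M -> 'rV[R]_m -> R) :
  connected [set: M] ->
  (forall a b x, overlap (atlas a) (atlas b) x ->
    f b (transition (atlas a) (atlas b) x) = f a x) ->
  (forall a x, cod (atlas a) x ->
    \forall y \near x, cod (atlas a) y /\ f a y = f a x) ->
  forall a x b y, cod (atlas a) x -> cod (atlas b) y -> f a x = f b y.
Proof.
move=> conM f_change f_loc a0 x0 b y xa yb.
have indep a b' p : dom (atlas a) p -> dom (atlas b') p ->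
    f a (Defs.coord (atlas a) p) = f b' (Defs.coord (atlas b') p).
  move=> pa pb; rewrite -(f_change a b').
    by rewrite /transition coordK.
  by split; [exact: coord_cod|rewrite coordK].
(* Taking [c] to be [id] or [not] gives this set and its complement, with a single proof of
   openness. *)
pose P (c : Prop -> Prop) := [set p : M |
  exists a, dom (atlas a) p /\ c (f a (Defs.coord (atlas a) p) = f a0 x0)].
have oP c : open (P c).
  rewrite openE => p [a [pa ca]].
  have near_p : \forall q \near p, dom (atlas a) q /\
      f a (Defs.coord (atlas a) q) = f a (Defs.coord (atlas a) p).
    have H : \forall q \near p, cod (atlas a) (Defs.coord (atlas a) q) /\
        f a (Defs.coord (atlas a) q) = f a (Defs.coord (atlas a) p).
      exact: coord_continuous_on pa _ (f_loc a _ (coord_cod pa)).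
    have dp : \forall q \near p, dom (atlas a) q.
      by apply: open_nbhs_nbhs; split => //; exact: dom_open.
    by apply: filterS (filterI dp H) => q [? []].
  by apply: filterS near_p => q [qa E]; exists a; rewrite E.
have PC : P id = ~` P not.
  apply/seteqP; split=> p.
    by move=> [a [pa E]] [a' [pa' E']]; apply: E'; rewrite -E; exact: indep.
  have [a pa] := atlas_cover p.
  by move=> H; exists a; split => //; apply: contrapT => E; apply: H; exists a.
have : P id = [set: M].
  apply: conM.
  - exists (param (atlas a0) x0); exists a0.
    by split; [exact: param_dom|rewrite paramK].
  - by exists (P id); [exact: oP|rewrite setTI].
  - by exists (P id); [rewrite PC; exact: open_closedC|rewrite setTI].
move/seteqP => [_ /(_ (param (atlas b) y) I)] [a [pa <-]].
by rewrite (indep _ b) // ?paramK //; exact: param_dom.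
Qed.

Theorem theorem4p2 (R : realType) (n : nat) (eps : R) (M : manifold R (2 * n))
    (g : metric M) (J : endo_field M) (S : tensor12 M) (xi zeta : vector_field M) :
  eps = -1 \/ eps = 1 ->
  (4 <= 2 * n)%N ->
  connected [set: M] ->
  eps_kahler eps g J ->
  homogeneous_eps_kahler g J S ->
  linear_type eps g J S xi zeta ->
  non_degenerate g xi ->
  exists c : R,
    [/\ forall a x, cod (atlas a) x ->
          c = - 4 * inner g a x (xi a x) (xi a x),
        constant_hol_curvature eps g J c
      & forall a x, cod (atlas a) x -> zeta a x = 0].
Proof.
move=> eps1 n4 conM kJ hS lS nd.
pose q a x := inner g a x (xi a x) (xi a x).
have q_const a x b y : cod (atlas a) x -> cod (atlas b) y -> q a x = q b y.
  apply: (chart_constant conM) => {a b x y} [a b x ab|a x ax].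
    by rewrite /q /inner (vf_change xi ab) gram_change.
  apply: near_eq_of_derive0 => //; first exact: cod_open.
    exact: smooth_inner (vf_smooth xi a) (vf_smooth xi a).
  move=> y v ay; exact: (derive_inn_xi eps1 n4 kJ hS lS nd).
have [c cE] : exists c : R, forall a x, cod (atlas a) x -> c = - 4 * q a x.
  (* An empty manifold has no value of [q] to take; 0 then serves, all conclusions being vacuous. *)
  have [[a [x ax]]|noM] := pselect (exists a x, cod (@atlas _ _ M a) x).
    by exists (- 4 * q a x) => b y yb; rewrite (q_const a x b y).
  by exists 0 => a x ax; case: noM; exists a, x.
exists c; split=> [||a x ax]; first exact: cE.
  move=> a X Y Z W sX sY sZ sW x ax /=.
  rewrite (constant_hol_curvature_at eps1 n4 kJ hS lS nd W sX sY sZ ax).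
  by rewrite (cE a x ax) /hol_form /q; field.
by have [] := zeta_zero_curv4 eps1 n4 kJ hS lS nd ax.
Qed.
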